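(* Let $\tau\colon E\to M$ be a smooth vector bundle with dual $\pi\colon E^*\to M$, let $\Lambda$ be a linear bivector field on $E^*$, and let $P\in\Gamma(M,\wedge^2E)$. Then the bivector field $d_T^\Lambda(P)$ on $E$ defines a pre-Lie algebroid structure on $E^*$ with the bracket $$[\mu,\nu]^{d_T^\Lambda(P)}=\mathcal L^\Lambda_{P_\mu}\nu-\mathcal L^\Lambda_{P_\nu}\mu-d^\Lambda\big(P(\mu,\nu)\big),\qquad \mu,\nu\in\Gamma(M,E^* ),$$ where $P_\mu=i_\mu P$, and the anchor $$\alpha^{d_T^\Lambda(P)}(\mu)=\alpha^\Lambda(P_\mu).$$
   Context: For a section $X$ of $E$, $\iota_{E^*}X$ is the fibrewise linear function $a\mapsto\langle X(\pi(a)),a\rangle$ on $E^*$; for a section $\mu$ of $E^*$, $\iota_E\mu$ is the corresponding fibrewise linear function on $E$; for a vector field $V$ on a manifold $Q$, $\iota_{T^*Q}V$ is the corresponding function on $T^*Q$. For a bivector field $\Lambda$, $\{f,g\}_\Lambda=\Lambda(df,dg)$. A bivector field $\Lambda$ on the total space $F^*$ of the dual of a vector bundle $p\colon F\to M$ is linear if $\{\iota_{F^*}X,\iota_{F^*}Y\}_\Lambda$ is fibrewise linear for all sections $X,Y$ of $F$. Such a $\Lambda$ defines a pre-Lie algebroid structure on $F$, i.e. a skew-symmetric bracket $[\,,\,]^\Lambda$ on $\Gamma(M,F)$ and an anchor $\alpha^\Lambda\colon F\to TM$ with $[X,fY]^\Lambda=f[X,Y]^\Lambda+\alpha^\Lambda(X)(f)Y$,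 given by $\iota_{F^*}[X,Y]^\Lambda=\{\iota_{F^*}X,\iota_{F^*}Y\}_\Lambda$ and $\alpha^\Lambda(X)(f)\circ q=\{\iota_{F^*}X,f\circ q\}_\Lambda$, where $q\colon F^*\to M$ is the projection. This is used for $F=E$ with $\Lambda$, and for $F=E^*$ (so $F^*=E$) with $d_T^\Lambda(P)$. For $f\in C^\infty(M)$, $\langle X,d^\Lambda f\rangle=\alpha^\Lambda(X)(f)$. For $X\in\Gamma(M,E)$, $\mu\in\Gamma(M,E^* )$: $\langle Y,\mathcal L^\Lambda_X\mu\rangle=\alpha^\Lambda(X)(\langle Y,\mu\rangle)-\langle[X,Y]^\Lambda,\mu\rangle$. Conventions: $X\wedge Y=X\otimes Y-Y\otimes X$, $(X\wedge Y)(\mu,\nu)=\langle X,\mu\rangle\langle Y,\nu\rangle-\langle Y,\mu\rangle\langle X,\nu\rangle$, and $\langle i_\mu P,\nu\rangle=P(\mu,\nu)$. The vertical lift $v_\tau\colon\bigoplus_k\Gamma(M,\otimes^kE)\to\bigoplus_k\Gamma(E,\otimes^kTE)$ is the algebra homomorphism with $v_\tau(f)=\tau^*f$ and $v_\tau(X)$ the vertical vector field constant along fibres with value $X$. The complete lift $d_T^\Lambda$ between the same tensor algebras is the unique degree-preserving linear map with $d_T^\Lambda(A\otimes B)=d_T^\Lambda(A)\otimes v_\tau(B)+v_\tau(A)\otimes d_T^\Lambda(B)$, $d_T^\Lambda(f)=\iota_E(d^\Lambda f)$ for functions, and $\iota_{T^*E}(d_T^\Lambda X)\circ\mathcal R=\iota_{T^*E^*}([\Lambda,\iota_{E^*}X])$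 for $X\in\Gamma(M,E)$, where $[\Lambda,h]$ is the vector field $g\mapsto\{g,h\}_\Lambda$ and $\mathcal R\colon T^*E^*\to T^*E$ is the canonical anti-symplectic isomorphism (in dual local linear coordinates $(x^a,y^i)$, $(x^a,\xi_i)$, it sends $p_adx^a+\eta^id\xi_i$ at $(x,\xi)$ to $-p_adx^a+\xi_idy^i$ at $(x,y)$, $y^i=\eta^i$). Locally, if $(e_i)$ is a frame of $E$, $[e_i,e_j]^\Lambda=c^k_{ij}e_k$ and $\alpha^\Lambda(e_i)=\delta^a_i\partial_{x^a}$, then $d_T^\Lambda(X^ie_i)=X^i\delta^a_i\partial_{x^a}+\big(X^ic^k_{ji}+\tfrac{\partial X^k}{\partial x^a}\delta^a_j\big)y^j\partial_{y^k}$. *)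

(* Defs.v *)
From HB Require Import structures.
From mathcomp Require Import all_boot all_order all_algebra.
From mathcomp Require Import boolp classical_sets functions reals.
From mathcomp Require Import interval_inference topology normedtype landau derive.
Import Order.TTheory GRing.Theory Num.Theory.
Import numFieldNormedType.Exports.

Set Implicit Arguments.
Unset Strict Implicit.
Unset Printing Implicit Defensive.

Local Open Scope classical_set_scope.
Local Open Scope ring_scope.

(* Definite description; [t0] is returned when nothing satisfies [P]. *)
Definition the (T : Type) (t0 : T) (P : T -> Prop) : T :=
  match pselect (exists t, P t) with
  | left h => projT1 (cid h)
  | right _ => t0
  end.

Section Ck.
Variables (R : realType) (V : normedModType R).
Implicit Types (O W : set V) (f g : V -> R).

(* For O open: f is C^0 on O if it is continuous at the points of O, and C^(k+1)
   if it is differentiable there with all its directional derivatives C^k. *)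
Fixpoint Ck (k : nat) (O : set V) (f : V -> R) : Prop :=
  match k with
  | 0%N => forall x, O x -> {for x, continuous f}
  | k'.+1 => (forall x, O x -> differentiable f x) /\
             (forall v, Ck k' O ('D_v f))
  end.

Definition Cinfty (O : set V) (f : V -> R) : Prop := forall k, Ck k O f.

Lemma Ck_pred k O f : Ck k.+1 O f -> Ck k O f.
Proof.
elim: k f => [|k IHk] f [df Df] /=; last by split=> // v; apply: IHk.
by move=> x Ox; apply: differentiable_continuous; apply: df.
Qed.

Lemma Cinfty_diff O f x : Cinfty O f -> O x -> differentiable f x.
Proof. by move=> /(_ 1%N)[+ _] Ox; apply. Qed.

Lemma Ck_sub k O W f : W `<=` O -> Ck k O f -> Ck k W f.
Proof.
move=> sWO; elim: k f => [|k IHk] f /=; first by move=> cf x /sWO; apply: cf.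
by move=> [df Df]; split=> [x /sWO|v]; [apply: df|apply: IHk].
Qed.

Lemma Ck_local k O f :
  (forall x, O x -> exists2 W : set V, W x & Ck k W f) -> Ck k O f.
Proof.
elim: k f => [|k IHk] f /= H; first by move=> x /H[W Wx]; apply.
split=> [x /H[W Wx [+ _]]|v]; first by apply.
by apply: IHk => x /H[W Wx [_ DW]]; exists W.
Qed.

Lemma near_eq_differentiable f g x :
  (\near x, f x = g x) -> differentiable f x -> differentiable g x.
Proof.
move=> fg df; have -> : g = f + (g - f) by rewrite addrC subrK.
apply: differentiableD => //; set h := g - f.
have h0 : \forall y \near x, h y = 0.
  by near=> y; rewrite /h !fctE (near fg y _) ?subrr.
have hE : h \o shift x = cst (h x) + \0 +o_ 0 id.
  apply/eqaddoP => _/posnumP[e]; rewrite (nbhs_singleton h0).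
  have : \forall y \near 0, h (y + x) = 0.
    rewrite (near_shift x) /= sub0r.
    by apply: filterS h0 => y; rewrite /= addrNK.
  apply: filterS => y hy.
  by rewrite !fctE /= hy addr0 subrr normr0 mulr_ge0.
apply/diff_locallyP; have -> : 'd h x = 0 :> (V -> R).
  by apply: diff_unique => //; apply: cst_continuous.
by split=> //; apply: cst_continuous.
Unshelve. all: by end_near. Qed.

Lemma Ck_ext k O f g : open O -> (forall x, O x -> f x = g x) ->
  Ck k O f -> Ck k O g.
Proof.
move=> oO; elim: k f g => [|k IHk] f g fg.
  move=> /= cf x Ox; have := cf x Ox; rewrite /prop_for /continuous_at fg// => cfx.
  apply: cvg_trans cfx; apply: near_eq_cvg.
  by near=> y; apply: fg; near: y; apply: open_nbhs_nbhs.
have nfg x : O x -> \forall y \near x, f y = g y.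
  by move=> Ox; near=> y; apply: fg; near: y; apply: open_nbhs_nbhs.
move=> [df Df]; split=> [x Ox|v].
  by apply: near_eq_differentiable (df x Ox); apply: nfg.
by apply: IHk (Df v) => x Ox; apply: near_eq_derive; apply: nfg.
Unshelve. all: by end_near. Qed.

Lemma Ck_cst k O a : Ck k O (cst a).
Proof.
elim: k a => [|k IHk] a /=; first by move=> x _; apply: cst_continuous.
split=> // v; suff -> : 'D_v (cst a : V -> R) = cst 0 by [].
by apply/funext => x; rewrite derive_cst.
Qed.

Lemma CkD k O f g : open O -> Ck k O f -> Ck k O g -> Ck k O (f + g).
Proof.
move=> oO; elim: k f g => [|k IHk] f g /=.
  by move=> cf cg x Ox; apply: continuousD; [apply: cf|apply: cg].
move=> [df Df] [dg Dg]; split=> [x Ox|v].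
  by apply: differentiableD; [apply: df|apply: dg].
apply: Ck_ext (IHk _ _ (Df v) (Dg v)) => // x Ox.
by rewrite deriveD//; apply: diff_derivable; [apply: df|apply: dg].
Qed.

Lemma CkM k O f g : open O -> Ck k O f -> Ck k O g -> Ck k O (f * g).
Proof.
move=> oO; elim: k f g => [|k IHk] f g.
  by move=> cf cg x Ox; apply: continuousM; [apply: cf|apply: cg].
move=> Cf Cg; have [df Df] := Cf; have [dg Dg] := Cg; split=> [x Ox|v].
  by apply: differentiableM; [apply: df|apply: dg].
have := CkD oO (IHk _ _ (Ck_pred Cf) (Dg v)) (IHk _ _ (Ck_pred Cg) (Df v)).
apply: Ck_ext => // x Ox.
by rewrite deriveM//; apply: diff_derivable; [apply: df|apply: dg].
Qed.

Lemma Ck_sum k O n (F : 'I_n -> V -> R) : open O -> (forall i, Ck k O (F i)) ->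
  Ck k O (fun x => \sum_i F i x).
Proof.
move=> oO CF; rewrite -fct_sumE; elim/big_ind: _ => //; first exact: Ck_cst.
by move=> f g; apply: CkD.
Qed.

End Ck.

Lemma Ck_comp_linear (R : realType) (V W : normedModType R) k
    (L : {linear V -> W}) (O : set W) (f : W -> R) : continuous L ->
  Ck k O f -> Ck k (L @^-1` O) (f \o L).
Proof.
move=> cL; elim: k f => [|k IHk] f /=.
  by move=> cf x Ox; exact: (continuous_comp (cL x) (cf (L x) Ox)).
move=> [df Df]; have dL x : differentiable L x by apply: linear_differentiable.
split=> [x Ox|v]; first exact: differentiable_comp (dL x) (df (L x) Ox).
have := IHk _ (Df (L v)).
suff -> : 'D_v (f \o L) = 'D_(L v) f \o L by [].
apply/funext => x; rewrite /derive /=.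
have E (h : R) : L (h *: v + x) = h *: L v + L x by rewrite linearD linearZ.
by under eq_fun do rewrite E.
Qed.

Lemma Ck_coord (R : realType) n k (O : set 'rV[R]_n) (i : 'I_n) :
  Ck k O (fun v : 'rV[R]_n => v ord0 i).
Proof.
case: k => [|k] /=; first by move=> x _; apply: coord_continuous.
split=> [x _|v]; first exact: differentiable_coord.
suff -> : 'D_v (fun w : 'rV[R]_n => w ord0 i) = cst (v ord0 i) by apply: Ck_cst.
apply/funext => x; rewrite /derive.
have E : {near 0^', (fun h : R => h^-1 *: ((h *: v + x) ord0 i - x ord0 i))
                    =1 cst (v ord0 i)}.
  near=> h; rewrite /= !mxE addrK /GRing.scale /= mulKf//.
  by near: h; apply: nbhs_dnbhs_neq.
apply/cvg_lim => //; apply: cvg_trans (near_eq_cvg _) (cvg_cst _).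
by apply: filterS E => h /= ->.
Unshelve. all: by end_near. Qed.

Section LinearAlgebra.
Variables (R : realType).

Definition upd (k : nat) (T : Type) (t : 'I_k -> T) (i : 'I_k) (x : T) : 'I_k -> T :=
  fun j => if j == i then x else t j.

Definition pair2 (T : Type) (a b : T) : 'I_2 -> T :=
  fun i => if i == ord0 then a else b.

Section Dual.
Variable V : lmodType R.

Definition linear_form : {pred V -> R} :=
  fun f => `[< forall a u v, f (a *: u + v) = a * f u + f v >].

Lemma linear_formP f :
  reflect (forall a u v, f (a *: u + v) = a * f u + f v) (f \in linear_form).
Proof. exact: asboolP. Qed.

Lemma linear_form_submod_closed : submod_closed linear_form.
Proof.
split=> [|c f g /linear_formP lf /linear_formP lg]; apply/linear_formP => a u v.
  by rewrite -[LHS]/0 -[RHS]/(a * 0 + 0) mulr0 addr0.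
by rewrite !fctE lf lg !scalerDr /GRing.scale /= mulrDr addrACA !mulrA (mulrC c a).
Qed.

HB.instance Definition _ :=
  GRing.isSubmodClosed.Build R (V -> R) linear_form linear_form_submod_closed.

Record dual := Dual { dual_fun :> V -> R; dual_funP : dual_fun \in linear_form }.
HB.instance Definition _ := [isSub for dual_fun].
HB.instance Definition _ := [Choice of dual by <:].
HB.instance Definition _ := [SubChoice_isSubLmodule of dual by <:].

HB.instance Definition _ (t : dual) :=
  GRing.isLinear.Build R V R^o *:%R (dual_fun t) (elimT (linear_formP _) (dual_funP t)).

End Dual.

Lemma dual_pull_subproof (U V : lmodType R) (L : {linear U -> V}) (t : dual V) :
  (fun u => t (L u)) \in @linear_form U.
Proof. by apply/linear_formP => a u v; rewrite !linearP. Qed.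

Definition dual_pull (U V : lmodType R) (L : {linear U -> V}) (t : dual V) : dual U :=
  Dual (dual_pull_subproof L t).

(* The k-th tensor power of a finite-dimensional V, realized as the space of
   k-linear forms on its dual. *)
Definition multilinear (V : lmodType R) k (t : ('I_k -> dual V) -> R) : Prop :=
  forall (x : 'I_k -> dual V) i a u v,
    t (upd x i (a *: u + v)) = a * t (upd x i u) + t (upd x i v).

Record tensor (V : lmodType R) (k : nat) := Tensor {
  tensor_fun :> ('I_k -> dual V) -> R;
  tensor_funP : multilinear tensor_fun }.

End LinearAlgebra.

Arguments linear_form {R V}.

(* A set with a family of local parametrizations (inverses of charts), each of
   them used on an open subset of R^dim. The total space of a vector bundle is
   given as such; smooth functions, tangent vectors and tensor fields depend on
   these data only. *)
Record atlas (R : realType) := Atlas {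
  pt :> Type;
  dim : nat;
  chart : Type;
  cdom : chart -> set 'rV[R]_dim;
  cpar : chart -> 'rV[R]_dim -> pt;
  cdom_open : forall c, open (cdom c) }.

Section Atlas.
Variables (R : realType) (Q : atlas R).

Definition open_in (W : set Q) : Prop :=
  forall c : chart Q, open (cdom c `&` cpar c @^-1` W).

Definition smooth_on (W : set Q) (f : Q -> R) : Prop :=
  forall c : chart Q, Cinfty (cdom c `&` cpar c @^-1` W) (f \o cpar c).

Lemma open_inT : open_in setT.
Proof. by move=> c; rewrite preimage_setT setIT; apply: cdom_open. Qed.

Lemma open_inI W W' : open_in W -> open_in W' -> open_in (W `&` W').
Proof.
move=> oW oW' c; rewrite preimage_setI -(setIid (cdom c)) setIACA.
by apply: openI; [apply: oW|apply: oW'].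
Qed.

Lemma smooth_cst W a : smooth_on W (cst a).
Proof. by move=> c k; apply: Ck_cst. Qed.

Lemma smoothD W f g : open_in W ->
  smooth_on W f -> smooth_on W g -> smooth_on W (f + g).
Proof.
by move=> oW sf sg c k; apply: CkD (sf c k) (sg c k); apply: oW.
Qed.

Lemma smoothM W f g : open_in W ->
  smooth_on W f -> smooth_on W g -> smooth_on W (f * g).
Proof.
by move=> oW sf sg c k; apply: CkM (sf c k) (sg c k); apply: oW.
Qed.

Lemma smooth_sum W n (F : 'I_n -> Q -> R) : open_in W ->
  (forall i, smooth_on W (F i)) -> smooth_on W (fun x => \sum_i F i x).
Proof.
move=> oW sF; rewrite -fct_sumE; elim/big_ind: _ => //; first exact: smooth_cst.
by move=> f g; apply: smoothD.
Qed.

Lemma smooth_ext W f g : open_in W ->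
  (forall x, W x -> f x = g x) -> smooth_on W f -> smooth_on W g.
Proof.
move=> oW fg sf c k; apply: Ck_ext (sf c k); first exact: oW.
by move=> x [_ Wx]; apply: fg.
Qed.

Lemma smooth_local f :
  (forall x, exists2 W : set Q, W x & smooth_on W f) -> smooth_on setT f.
Proof.
move=> H c k; apply: Ck_local => u [cu _]; have [W Wu sW] := H (cpar c u).
by exists (cdom c `&` cpar c @^-1` W) => //; apply: sW.
Qed.

Definition smooth : {pred Q -> R} := fun f => `[< smooth_on setT f >].

Lemma smoothP f : reflect (smooth_on setT f) (f \in smooth).
Proof. exact: asboolP. Qed.

Lemma smooth_subring_closed : subring_closed smooth.
Proof.
split=> [|f g /smoothP sf /smoothP sg|f g /smoothP sf /smoothP sg]; apply/smoothP.
- exact: smooth_cst.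
- rewrite -mulN1r; apply: smoothD => //; first exact: open_inT.
  by apply: smoothM => //; [exact: open_inT|exact: (smooth_cst setT (-1))].
- by apply: smoothM => //; exact: open_inT.
Qed.

Lemma smooth_submod_closed : submod_closed smooth.
Proof.
split=> [|a f g /smoothP sf /smoothP sg]; apply/smoothP; first exact: smooth_cst.
apply: smoothD => //; first exact: open_inT.
by apply: (@smoothM setT (cst a)) => //; [exact: open_inT|exact: smooth_cst].
Qed.

HB.instance Definition _ := GRing.isSubringClosed.Build (Q -> R) smooth
  smooth_subring_closed.
HB.instance Definition _ := GRing.isSubmodClosed.Build R (Q -> R) smooth
  smooth_submod_closed.

Record cinf := Cinf { cinf_fun :> Q -> R; cinf_funP : cinf_fun \in smooth }.
HB.instance Definition _ := [isSub for cinf_fun].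
HB.instance Definition _ := [Choice of cinf by <:].
HB.instance Definition _ := 
  GRing.SubChoice_isSubComPzRing.Build (Q -> R) smooth cinf smooth_subring_closed.
HB.instance Definition _ := [SubZmodule_isSubLmodule of cinf by <:].

Lemma cinf_smooth (f : cinf) : smooth_on setT f.
Proof. exact/smoothP/cinf_funP. Qed.

Lemma cinf_diff (f : cinf) c u : cdom c u -> differentiable (f \o cpar c) u.
Proof. by move=> cu; apply: (Cinfty_diff (cinf_smooth f c)). Qed.

(* Tangent vectors at q: derivations at q of the algebra of smooth functions. *)
Definition derivation (q : Q) : {pred cinf -> R} :=
  fun v => `[< (forall a (f g : cinf), v (a *: f + g) = a * v f + v g) /\
               (forall f g : cinf, v (f * g) = f q * v g + g q * v f) >].

Lemma derivationP q v :
  reflect ((forall a (f g : cinf), v (a *: f + g) = a * v f + v g) /\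
           (forall f g : cinf, v (f * g) = f q * v g + g q * v f))
          (v \in derivation q).
Proof. exact: asboolP. Qed.

Lemma derivation_submod_closed q : submod_closed (derivation q).
Proof.
split=> [|c v w /derivationP[lv dv] /derivationP[lw dw]]; apply/derivationP.
  split=> [a f g|f g]; first by rewrite -[LHS]/0 -[RHS]/(a * 0 + 0) mulr0 addr0.
  by rewrite -[LHS]/0 -[RHS]/(f q * 0 + g q * 0) !mulr0 addr0.
split=> [a f g|f g]; rewrite !fctE /GRing.scale /=.
  by rewrite lv lw !mulrDr addrACA !mulrA (mulrC c a).
by rewrite dv dw !mulrDr addrACA !(mulrCA c).
Qed.

HB.instance Definition _ q := GRing.isSubmodClosed.Build R (cinf -> R)
  (derivation q) (derivation_submod_closed q).

Record tangent (q : Q) := Tangent {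
  tangent_fun :> cinf -> R; tangent_funP : tangent_fun \in derivation q }.
HB.instance Definition _ q := [isSub for @tangent_fun q].
HB.instance Definition _ q := [Choice of tangent q by <:].
HB.instance Definition _ q := [SubChoice_isSubLmodule of tangent q by <:].

Lemma diff_at_subproof q (f : cinf) : (fun v : tangent q => v f) \in linear_form.
Proof. by apply/linear_formP. Qed.

Definition diff_at (f : cinf) (q : Q) : dual (tangent q) :=
  Dual (diff_at_subproof q f).

Lemma chart_vec_subproof c u (cu : cdom c u) (v : 'rV[R]_(dim Q)) :
  (fun f : cinf => 'D_v (f \o cpar c) u) \in derivation (cpar c u).
Proof.
have dv (f : cinf) : derivable (f \o cpar c) u v.
  exact/diff_derivable/cinf_diff.
apply/derivationP; split=> [a f g|f g].
  have -> : (a *: f + g : cinf) \o cpar c = a *: (f \o cpar c) + (g \o cpar c) by [].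
  by rewrite deriveD ?deriveZ//; apply: derivableZ.
have -> : (f * g : cinf) \o cpar c = (f \o cpar c) * (g \o cpar c) by [].
by rewrite deriveM.
Qed.

(* With v a vector of the standard basis: the coordinate vector at cpar c u. *)
Definition chart_vec c u (cu : cdom c u) (v : 'rV[R]_(dim Q)) : tangent (cpar c u) :=
  Tangent (chart_vec_subproof cu v).

(* Contravariant tensor fields; smoothness is tested on exact 1-forms. *)
Record tensor_field (k : nat) := TensorField {
  tfield :> forall q : Q, tensor (tangent q) k;
  tfieldP : forall f : 'I_k -> cinf,
    smooth_on setT (fun q => tfield q (fun j => diff_at (f j) q)) }.

Definition bivector (B : tensor_field 2) : Prop :=
  forall q (a b : dual (tangent q)), B q (pair2 a b) = - B q (pair2 b a).

Lemma pbracket_subproof (B : tensor_field 2) (f g : cinf) :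
  (fun q => B q (pair2 (diff_at f q) (diff_at g q))) \in smooth.
Proof.
apply/smoothP; have := tfieldP B (pair2 f g).
congr (smooth_on _ _); apply/funext => q; congr (tensor_fun (B q) _).
by apply/funext => j; rewrite /pair2; case: ifP.
Qed.

Definition pbracket (B : tensor_field 2) (f g : cinf) : cinf :=
  Cinf (pbracket_subproof B f g).

Lemma ham_subproof (B : tensor_field 2) (h : cinf) q :
  (fun g : cinf => pbracket B g h q) \in derivation q.
Proof.
have lB (a b c : dual (tangent q)) x :
    B q (pair2 (x *: a + b) c) = x * B q (pair2 a c) + B q (pair2 b c).
  have updc d : pair2 d c = upd (pair2 c c) ord0 d.
    by apply/funext => j; rewrite /upd /pair2; case: eqP.
  by rewrite (updc (x *: a + b)) (updc a) (updc b) tensor_funP.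
apply/derivationP; split=> [a f g|f g] /=.
  rewrite -lB; congr (tensor_fun _ (pair2 _ _)).
  by apply: val_inj; apply/funext => -[v vP] /=; have /derivationP[] := vP.
have -> : diff_at (f * g) q = f q *: diff_at g q + g q *: diff_at f q.
  by apply: val_inj; apply/funext => -[v vP] /=; have /derivationP[] := vP.
have B0 c : B q (pair2 0 c) = 0.
  have /eqP := lB 0 0 c 1; rewrite scaler0 addr0 mul1r.
  by rewrite -subr_eq subrr eq_sym => /eqP.
by rewrite lB -[g q *: _]addr0 lB B0 addr0.
Qed.

(* The vector field [B, h] : g |-> {g, h}_B. *)
Definition ham (B : tensor_field 2) (h : cinf) (q : Q) : tangent q :=
  Tangent (ham_subproof B h q).

End Atlas.

Arguments smooth {R Q}.

(* A smooth manifold of dimension dim M, without boundary: the changes of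
   coordinates are smooth, and the topology whose open sets are those of open_in
   is Hausdorff and second countable. *)
Record manifold (R : realType) := Manifold {
  matlas :> atlas R;
  cpar_inj : forall c : chart matlas, {in cdom c &, injective (cpar c)};
  cpar_cover : forall x : matlas, exists c u, cdom c u /\ cpar c u = x;
  cpar_change : forall c d : chart matlas,
    let D := cdom c `&` cpar c @^-1` (cpar d @` cdom d) in
    open D /\
    exists g : 'rV[R]_(dim matlas) -> 'rV[R]_(dim matlas),
      (forall u, D u -> cdom d (g u) /\ cpar d (g u) = cpar c u) /\
      (forall a, Cinfty D (fun u => g u ord0 a));
  hausdorff_manifold : forall x y : matlas, x <> y ->
    exists U V : set matlas,
      [/\ open_in U, open_in V, U x, V y & U `&` V = set0];
  second_countable_manifold : exists B : nat -> set matlas,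
    (forall n, open_in (B n)) /\
    (forall (W : set matlas) x, open_in W -> W x ->
       exists n, B n x /\ B n `<=` W) }.

(* A smooth vector bundle of rank rk over M: over each member tdom i of an open
   cover, tpar i is a fibrewise linear trivialization with inverse tco i, and the
   transition functions are smooth. Outside tdom i, tpar i and tco i are junk. *)
Record vbundle (R : realType) (M : manifold R) := VBundle {
  fib :> M -> lmodType R;
  rk : nat;
  triv : Type;
  tdom : triv -> set M;
  tpar : triv -> forall x, {linear 'rV[R]_rk -> fib x};
  tco : triv -> forall x, {linear fib x -> 'rV[R]_rk};
  tdom_open : forall i, open_in (tdom i);
  tdom_cover : forall x, exists i, tdom i x;
  tparK : forall i x, tdom i x -> cancel (tpar i x) (tco i x);
  tcoK : forall i x, tdom i x -> cancel (tco i x) (tpar i x);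
  tchange : forall i j (v : 'rV[R]_rk) k,
    smooth_on (tdom i `&` tdom j) (fun x => tco j x (tpar i x v) ord0 k) }.

Section Bundle.
Variables (R : realType) (M : manifold R).

Section DualBundle.
Variable E : vbundle M.

Lemma dpar_subproof (i : triv E) x (v : 'rV[R]_(rk E)) :
  (fun e : E x => \sum_k v ord0 k * tco i x e ord0 k) \in linear_form.
Proof.
apply/linear_formP => a e f; rewrite mulr_sumr -big_split; apply: eq_bigr => k _ /=.
by rewrite linearP !mxE mulrDr mulrCA.
Qed.

Definition dpar_fun i x v : dual (E x) := Dual (dpar_subproof i x v).

Lemma dpar_is_linear i x : linear (dpar_fun i x).
Proof.
move=> a v w; apply: val_inj; apply/funext => e /=.
rewrite !fctE /GRing.scale /= mulr_sumr -big_split; apply: eq_bigr => k _ /=.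
by rewrite !mxE mulrDl mulrA.
Qed.

HB.instance Definition _ i x :=
  GRing.isLinear.Build R 'rV[R]_(rk E) (dual (E x)) *:%R (dpar_fun i x)
    (dpar_is_linear i x).

Definition dco_fun (i : triv E) x (t : dual (E x)) : 'rV[R]_(rk E) :=
  \row_k t (tpar i x (delta_mx ord0 k)).

Lemma dco_is_linear i x : linear (@dco_fun i x).
Proof. by move=> a s t; apply/rowP => k; rewrite !mxE. Qed.

HB.instance Definition _ i x :=
  GRing.isLinear.Build R (dual (E x)) 'rV[R]_(rk E) *:%R (@dco_fun i x)
    (@dco_is_linear i x).

Definition dpar i x : {linear 'rV[R]_(rk E) -> dual (E x)} := dpar_fun i x.
Definition dco i x : {linear dual (E x) -> 'rV[R]_(rk E)} := @dco_fun i x.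

Lemma dual_tparE (i : triv E) x (t : dual (E x)) (v : 'rV[R]_(rk E)) :
  t (tpar i x v) = \sum_k v ord0 k * dco i x t ord0 k.
Proof.
rewrite [v in LHS]row_sum_delta !linear_sum; apply: eq_bigr => k _.
by rewrite !linearZ /= mxE.
Qed.

Lemma dparK i x : tdom i x -> cancel (dpar i x) (dco i x).
Proof.
move=> ix v; apply/rowP => k; rewrite mxE /= (bigD1 k) //= tparK// big1 ?addr0.
  by rewrite mxE !eqxx mulr1.
by move=> l lk; rewrite mxE (negPf lk) andbF mulr0.
Qed.

Lemma dcoK i x : tdom i x -> cancel (dco i x) (dpar i x).
Proof.
move=> ix t; apply: val_inj; apply/funext => e /=.
rewrite -[in RHS](tcoK ix e) dual_tparE.
by apply: eq_bigr => k _; rewrite mulrC.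
Qed.

Lemma dchange i j (v : 'rV[R]_(rk E)) k :
  smooth_on (tdom i `&` tdom j) (fun x => dco j x (dpar i x v) ord0 k).
Proof.
have -> : (fun x => dco j x (dpar i x v) ord0 k) =
    (fun x => \sum_l v ord0 l * tco i x (tpar j x (delta_mx ord0 k)) ord0 l).
  by apply/funext => x; rewrite mxE.
have oij : open_in (tdom i `&` tdom j).
  by apply: open_inI; apply: tdom_open.
apply: smooth_sum => // l; apply: (@smoothM _ _ _ (cst _)) => //.
  exact: smooth_cst.
by rewrite setIC; apply: tchange.
Qed.

Definition dual_bundle : vbundle M :=
  @VBundle R M (fun x => dual (E x)) (rk E) (triv E) (@tdom _ _ E) dpar dco
    (@tdom_open _ _ E) (@tdom_cover _ _ E) dparK dcoK dchange.

End DualBundle.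

Section Sections.
Variable E : vbundle M.

Record section := MkSection {
  sec :> forall x, E x;
  secP : forall (i : triv E) k,
    smooth_on (tdom i) (fun x => tco i x (sec x) ord0 k) }.

Lemma section0_subproof (i : triv E) k :
  smooth_on (tdom i) (fun x => tco i x 0 ord0 k).
Proof.
have -> : (fun x => tco i x 0 ord0 k) = cst 0.
  by apply/funext => x; rewrite linear0 mxE.
exact: smooth_cst.
Qed.

Definition section0 : section := MkSection section0_subproof.

Lemma section_lin_subproof (f : cinf M) (X Y : section) (i : triv E) k :
  smooth_on (tdom i) (fun x => tco i x (f x *: X x + Y x) ord0 k).
Proof.
have -> : (fun x => tco i x (f x *: X x + Y x) ord0 k) =
    (f : M -> R) * (fun x => tco i x (X x) ord0 k) + (fun x => tco i x (Y x) ord0 k).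
  by apply/funext => x; rewrite linearP !mxE.
have oi : open_in (tdom i) by apply: tdom_open.
apply: smoothD => //; last exact: secP.
apply: smoothM => //; last exact: secP.
move=> c l; apply: Ck_sub (cinf_smooth f c l).
by rewrite preimage_setT setIT; apply: subIsetl.
Qed.

Definition section_lin f X Y : section := MkSection (section_lin_subproof f X Y).

Lemma tot_open (ci : chart M * triv E) :
  open [set z : 'rV[R]_(dim M + rk E) |
    cdom ci.1 (lsubmx z) /\ tdom ci.2 (cpar ci.1 (lsubmx z))].
Proof.
apply: (@open_comp _ _ lsubmx (cdom ci.1 `&` cpar ci.1 @^-1` tdom ci.2)).
  by move=> z _; apply: continuous_lsubmx.
exact: tdom_open.
Qed.

Definition tot : atlas R :=
  @Atlas R {x : M & E x} (dim M + rk E) (chart M * triv E)%type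
    (fun ci => [set z | cdom ci.1 (lsubmx z) /\ tdom ci.2 (cpar ci.1 (lsubmx z))])
    (fun ci z => existT _ (cpar ci.1 (lsubmx z))
                          (tpar ci.2 (cpar ci.1 (lsubmx z)) (rsubmx z)))
    tot_open.

End Sections.

Lemma pull_subproof (E : vbundle M) (f : cinf M) :
  (fun y : tot E => f (projT1 y)) \in smooth.
Proof.
apply/smoothP => -[c i] k /=; rewrite preimage_setT setIT.
apply: Ck_sub (Ck_comp_linear (@continuous_lsubmx _ _ _ _) (cinf_smooth f c k)).
by move=> z [].
Qed.

Definition pull (E : vbundle M) (f : cinf M) : cinf (tot E) :=
  Cinf (pull_subproof E f).

Lemma fibre_linear_smooth (E : vbundle M) (h : tot E -> R)
    (a : triv E -> 'I_(rk E) -> M -> R) :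
  (forall i k, smooth_on (tdom i) (a i k)) ->
  (forall i x v, tdom i x ->
     h (existT _ x (tpar i x v)) = \sum_k v ord0 k * a i k x) ->
  h \in smooth.
Proof.
move=> sa hE; apply/smoothP => -[c i] n; rewrite preimage_setT setIT.
set D := cdom _; have oD : open D by apply: cdom_open.
apply: (@Ck_ext _ _ _ _ (fun z => \sum_k rsubmx z ord0 k *
    (a i k \o cpar c \o lsubmx) z)) => //.
  by move=> z [_ iz]; rewrite /= hE.
apply: Ck_sum => // k; apply: CkM => //.
  have -> : (fun z : 'rV[R]_(dim M + rk E) => rsubmx z ord0 k) =
      (fun z => z ord0 (rshift (dim M) k)) by apply/funext => z; rewrite mxE.
  exact: Ck_coord.
exact: Ck_comp_linear (@continuous_lsubmx _ _ _ _) (sa i k c n).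
Qed.

Lemma pairing_subproof (E : vbundle M) (X : section E)
  (mu : section (dual_bundle E)) : (fun x => mu x (X x)) \in smooth.
Proof.
apply/smoothP/smooth_local => x; have [i ix] := tdom_cover E x.
have oi : open_in (tdom i) by apply: tdom_open.
exists (tdom i) => //.
apply: (@smooth_ext _ _ _ (fun x => \sum_k tco i x (X x) ord0 k *
    tco (i : triv (dual_bundle E)) x (mu x) ord0 k)) => //.
  by move=> y iy; rewrite /= -dual_tparE tcoK.
apply: smooth_sum => // k; apply: smoothM => //; first exact: (secP X i k).
exact: (@secP (dual_bundle E) mu i k).
Qed.

Definition pairing (E : vbundle M) (X : section E)
  (mu : section (dual_bundle E)) : cinf M := Cinf (pairing_subproof X mu).

Lemma iota_dual_subproof (E : vbundle M) (X : section E) :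
  (fun a : tot (dual_bundle E) => projT2 a (X (projT1 a))) \in smooth.
Proof.
apply: (@fibre_linear_smooth (dual_bundle E) _
  (fun (i : triv E) k x => tco i x (X x) ord0 k)) => // i k.
exact: (secP X i k).
Qed.

Definition iota_dual (E : vbundle M) (X : section E) : cinf (tot (dual_bundle E)) :=
  Cinf (iota_dual_subproof X).

Lemma iota_bundle_subproof (E : vbundle M) (mu : section (dual_bundle E)) :
  (fun y : tot E => mu (projT1 y) (projT2 y)) \in smooth.
Proof.
apply: (@fibre_linear_smooth E _
  (fun i k x => tco (i : triv (dual_bundle E)) x (mu x) ord0 k)).
  by move=> i k; exact: (@secP (dual_bundle E) mu i k).
by move=> i x v _ /=; rewrite dual_tparE.
Qed.

Definition iota_bundle (E : vbundle M) (mu : section (dual_bundle E)) : cinf (tot E) :=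
  Cinf (iota_bundle_subproof mu).

End Bundle.

Section VerticalLift.
Variables (R : realType) (M : manifold R) (E : vbundle M).

Definition vert_fun (y : tot E) (e : E (projT1 y)) : cinf (tot E) -> R :=
  fun f => derive1 (fun s : R => f (existT _ (projT1 y) (projT2 y + s *: e))) 0.

Lemma vert_funE (y : tot E) : exists (ci : chart (tot E)) z,
  [/\ cdom ci z, cpar ci z = y &
      exists L : {linear E (projT1 y) -> 'rV[R]_(dim (tot E))},
      forall e f, vert_fun e f = 'D_(L e) (f \o cpar ci) z].
Proof.
case: y => x y.
have [c [u [cu xE]]] := cpar_cover x; have [i ix] := tdom_cover E x.
subst x; set x := cpar c u.
pose L e : 'rV[R]_(dim M + rk E) := row_mx 0 (tco i x e).
have lL : linear L.
  by move=> a e f; rewrite /L linearP scale_row_mx add_row_mx scaler0 addr0.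
pose LM := GRing.isLinear.Build R (E x) 'rV[R]_(dim M + rk E) *:%R L lL.
pose LL : {linear E x -> 'rV[R]_(dim M + rk E)} := HB.pack L LM.
exists (c, i), (row_mx u (tco i x y)); split.
- by rewrite /= row_mxKl.
- by rewrite /= row_mxKl row_mxKr tcoK.
exists LL => e f; rewrite /vert_fun derive1E /derive /=.
have E0 (h : R) : existT (fun x : M => E x) x (y + (h *: 1 + 0) *: e) =
    cpar ((c, i) : chart (tot E)) (h *: L e + row_mx u (tco i x y)).
  rewrite /L scale_row_mx scaler0 add_row_mx add0r /= row_mxKl row_mxKr.
  by rewrite linearD linearZ /= !tcoK// addr0 [h *: 1]mulr1 addrC.
have E1 : existT (fun x : M => E x) x (y + 0 *: e) = 
    cpar ((c, i) : chart (tot E)) (row_mx u (tco i x y)).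
  by rewrite /= row_mxKl row_mxKr tcoK// scale0r addr0.
by under eq_fun do rewrite E0 E1.
Qed.

Lemma vert_subproof (y : tot E) (e : E (projT1 y)) : vert_fun e \in derivation y.
Proof.
have [ci [z [ciz yE [L vE]]]] := vert_funE y.
have /derivationP[lv dv] := chart_vec_subproof ciz (L e).
by apply/derivationP; split=> [a f g|f g]; rewrite !vE ?lv ?dv ?yE.
Qed.

Definition vert (y : tot E) (e : E (projT1 y)) : tangent y := Tangent (vert_subproof e).

Lemma vert_is_linear (y : tot E) : linear (@vert y).
Proof.
have [ci [z [ciz yE [L vE]]]] := vert_funE y.
move=> a e f; apply: val_inj; apply/funext => g /=.
rewrite !fctE /GRing.scale /= !vE linearP.
have df : differentiable (g \o cpar ci) z by apply: cinf_diff.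
by rewrite !deriveE// linearP.
Qed.

HB.instance Definition _ (y : tot E) :=
  GRing.isLinear.Build R (E (projT1 y)) (tangent y) *:%R (@vert y) (@vert_is_linear y).

End VerticalLift.

Arguments vert {R M E} y e.

Section Tensors.
Variables (R : realType) (V : lmodType R).

Lemma tensor0_subproof (a : R) : multilinear (fun _ : 'I_0 -> dual V => a).
Proof. by move=> ? []. Qed.

Definition tensor0 a : tensor V 0 := Tensor (tensor0_subproof a).

Lemma tensor1_subproof (u : V) :
  multilinear (fun t : 'I_1 -> dual V => t ord0 u).
Proof. by move=> t i a b c; rewrite /upd (ord1 i) eqxx. Qed.

Definition tensor1 u : tensor V 1 := Tensor (tensor1_subproof u).

Lemma tensor_prod_subproof k l (A : tensor V k) (B : tensor V l) :
  multilinear (fun t : 'I_(k + l) -> dual V =>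
    A (t \o @lshift k l) * B (t \o @rshift k l)).
Proof.
move=> t i a u v; case: (splitP i) => j ij.
  have -> : i = lshift l j by apply: val_inj.
  have El w : upd t (lshift l j) w \o @lshift k l = upd (t \o @lshift k l) j w.
    by apply/funext => m; rewrite /upd /= eq_lshift.
  have Er w : upd t (lshift l j) w \o @rshift k l = t \o @rshift k l.
    by apply/funext => m; rewrite /upd /= eq_rlshift.
  by rewrite !El !Er tensor_funP mulrDl mulrA.
have -> : i = rshift k j by apply: val_inj.
have El w : upd t (rshift k j) w \o @lshift k l = t \o @lshift k l.
  by apply/funext => m; rewrite /upd /= eq_lrshift.
have Er w : upd t (rshift k j) w \o @rshift k l = upd (t \o @rshift k l) j w.
  by apply/funext => m; rewrite /upd /= eq_rshift.
by rewrite !El !Er tensor_funP mulrDr mulrCA.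
Qed.

Definition tensor_prod k l (A : tensor V k) (B : tensor V l) : tensor V (k + l) :=
  Tensor (tensor_prod_subproof A B).

Lemma tensor_lin_subproof k a (A B : tensor V k) :
  multilinear (fun t => a * A t + B t).
Proof.
move=> t i b u v; rewrite !tensor_funP !mulrDr addrACA; congr (_ + _ + _).
by rewrite mulrCA.
Qed.

Definition tensor_lin k a (A B : tensor V k) : tensor V k :=
  Tensor (tensor_lin_subproof a A B).

End Tensors.

Lemma tensor_push_subproof (R : realType) (U V : lmodType R) (L : {linear U -> V})
    k (A : tensor U k) :
  multilinear (fun t : 'I_k -> dual V => A (fun j => dual_pull L (t j))).
Proof.
move=> t i a u v.
have E w : (fun j => dual_pull L (upd t i w j)) =
    upd (fun j => dual_pull L (t j)) i (dual_pull L w).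
  by apply/funext => j; rewrite /upd; case: ifP.
rewrite !E -tensor_funP; congr (tensor_fun A (upd _ _ _)).
by apply: val_inj.
Qed.

Definition tensor_push (R : realType) (U V : lmodType R) (L : {linear U -> V})
    k (A : tensor U k) : tensor V k :=
  Tensor (tensor_push_subproof L A).

Section TensorSections.
Variables (R : realType) (M : manifold R) (E : vbundle M).

(* Sections of the k-th tensor power of E; smoothness is tested on sections of
   E^*. *)
Record tensor_section (k : nat) := TensorSection {
  tsec :> forall x : M, tensor (E x) k;
  tsecP : forall mu : 'I_k -> section (dual_bundle E),
    smooth_on setT (fun x => tsec x (fun j => mu j x)) }.

Lemma tsection0_subproof (f : cinf M) (mu : 'I_0 -> section (dual_bundle E)) :
  smooth_on setT (fun x => tensor0 (E x) (f x) (fun j => mu j x)).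
Proof. exact: cinf_smooth. Qed.

Definition tsection0 f : tensor_section 0 := TensorSection (tsection0_subproof f).

Lemma tsection1_subproof (X : section E) (mu : 'I_1 -> section (dual_bundle E)) :
  smooth_on setT (fun x => tensor1 (X x) (fun j => mu j x)).
Proof. exact: (cinf_smooth (pairing X (mu ord0))). Qed.

Definition tsection1 X : tensor_section 1 := TensorSection (tsection1_subproof X).

Lemma tsection_prod_subproof k l (A : tensor_section k) (B : tensor_section l)
    (mu : 'I_(k + l) -> section (dual_bundle E)) :
  smooth_on setT (fun x => tensor_prod (A x) (B x) (fun j => mu j x)).
Proof.
apply: smoothM; first exact: open_inT.
  exact: (tsecP A (mu \o @lshift k l)).
exact: (tsecP B (mu \o @rshift k l)).
Qed.

Definition tsection_prod k l A B : tensor_section (k + l) :=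
  TensorSection (@tsection_prod_subproof k l A B).

Lemma tsection_lin_subproof k a (A B : tensor_section k)
    (mu : 'I_k -> section (dual_bundle E)) :
  smooth_on setT (fun x => tensor_lin a (A x) (B x) (fun j => mu j x)).
Proof.
apply: smoothD; first exact: open_inT; last exact: tsecP.
apply: (@smoothM _ _ _ (cst a)); [exact: open_inT|exact: smooth_cst|exact: tsecP].
Qed.

Definition tsection_lin k a A B : tensor_section k :=
  TensorSection (@tsection_lin_subproof k a A B).

(* The sections of the exterior square, which is the space of skew-symmetric
   2-tensors since X /\ Y is X (x) Y - Y (x) X. *)
Definition skew_section (P : tensor_section 2) : Prop :=
  forall x (a b : dual (E x)), P x (pair2 a b) = - P x (pair2 b a).

Lemma tsec_eval_subproof (P : tensor_section 2) (mu nu : section (dual_bundle E)) :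
  (fun x => P x (pair2 (mu x) (nu x))) \in smooth.
Proof.
apply/smoothP; have := tsecP P (pair2 mu nu).
congr (smooth_on _ _); apply/funext => x; congr (tensor_fun (P x) _).
by apply/funext => j; rewrite /pair2; case: ifP.
Qed.

Definition tsec_eval P mu nu : cinf M := Cinf (tsec_eval_subproof P mu nu).

Definition contract (P : tensor_section 2) (mu : section (dual_bundle E)) :
    section E :=
  the (section0 E) (fun X => forall (nu : section (dual_bundle E)) x,
    nu x (X x) = P x (pair2 (mu x) (nu x))).

(* The vertical lift of a tensor at projT1 y to a tensor at y; v_tau(A) is
   y |-> vlift y (A (projT1 y)). *)
Definition vlift (y : tot E) k (A : tensor (E (projT1 y)) k) : tensor (tangent y) k :=
  tensor_push (vert y) A.

End TensorSections.

Section PreLie.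
Variables (R : realType) (M : manifold R).

(* Smooth vector bundle morphisms from F to TM. *)
Record anchor_map (F : vbundle M) := AnchorMap {
  amap :> forall x, {linear F x -> tangent x};
  amapP : forall (X : section F) (f : cinf M),
    (fun x => amap x (X x) f) \in smooth }.

Lemma anchor0_subproof (F : vbundle M) (X : section F) (f : cinf M) :
  (fun x => (\0 : F x -> tangent x) (X x) f) \in smooth.
Proof. exact/smoothP/smooth_cst. Qed.

Definition anchor0 F : anchor_map F :=
  @AnchorMap F (fun x => (\0 : F x -> tangent x)) (@anchor0_subproof F).

Definition act (F : vbundle M) (alpha : anchor_map F) (X : section F) (f : cinf M) :
  cinf M := Cinf (amapP alpha X f).

Definition sscale (F : vbundle M) (f : cinf M) (X : section F) : section F :=
  section_lin f X (section0 F).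

Definition pre_lie (F : vbundle M) (br : section F -> section F -> section F)
    (alpha : anchor_map F) : Prop :=
  [/\ (forall X Y x, br X Y x = - br Y X x),
      (forall (a : R) X Y Z x,
         br X (section_lin (a *: (1 : cinf M)) Y Z) x = a *: br X Y x + br X Z x) &
      (forall X Y f x,
         br X (sscale f Y) x = f x *: br X Y x + act alpha X f x *: Y x)].

Section Induced.
(* G is the dual of F, and io X is the fibrewise linear function on G given by a
   section X of F: io is iota_dual for F = E and G = E^*, and iota_bundle for
   F = E^* and G = E. *)
Variables (F G : vbundle M) (io : section F -> cinf (tot G)).
Variable B : tensor_field (tot G) 2.

Definition fibrewise_linear (h : tot G -> R) : Prop :=
  forall x a (u v : G x),
    h (existT _ x (a *: u + v)) = a * h (existT _ x u) + h (existT _ x v).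

Definition linear_bivector : Prop :=
  bivector B /\ forall X Y, fibrewise_linear (pbracket B (io X) (io Y)).

Definition bracket (X Y : section F) : section F :=
  the (section0 F) (fun Z => io Z = pbracket B (io X) (io Y)).

Definition anchor : anchor_map F :=
  the (anchor0 F) (fun alpha => forall X f,
    pull G (act alpha X f) = pbracket B (io X) (pull G f)).

(* bracket and anchor exist and form a pre-Lie algebroid structure on F. *)
Definition defines_pre_lie : Prop :=
  [/\ pre_lie bracket anchor,
      (forall X Y, io (bracket X Y) = pbracket B (io X) (io Y)) &
      (forall X f, pull G (act anchor X f) = pbracket B (io X) (pull G f))].

End Induced.

Section Calculus.
Variables (E : vbundle M) (Lam : tensor_field (tot (dual_bundle E)) 2).

Definition bracketLam := bracket (@iota_dual R M E) Lam.
Definition anchorLam := anchor (@iota_dual R M E) Lam.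

Definition dLam (f : cinf M) : section (dual_bundle E) :=
  the (section0 _) (fun mu => forall X, pairing X mu = act anchorLam X f).

Definition lieLam (X : section E) (mu : section (dual_bundle E)) :
    section (dual_bundle E) :=
  the (section0 _) (fun nu => forall Y,
    pairing Y nu = act anchorLam X (pairing Y mu) - pairing (bracketLam X Y) mu).

End Calculus.

(* ga is the image of be under the canonical isomorphism from T^*E^* to T^*E. Here
   z and w are the coordinates (x, xi) and (x, y) of the base points of be and ga in
   dual local linear coordinates; the coefficient of be (resp. ga) on the
   differential of a coordinate is its value on the corresponding coordinate
   vector. *)
Definition canonical_iso (E : vbundle M) (c : chart M) (i : triv E)
    (z w : 'rV[R]_(dim M + rk E))
    (cz : cdom ((c, i) : chart (tot (dual_bundle E))) z)
    (cw : cdom ((c, i) : chart (tot E)) w)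
    (be : dual (tangent (cpar ((c, i) : chart (tot (dual_bundle E))) z)))
    (ga : dual (tangent (cpar ((c, i) : chart (tot E)) w))) : Prop :=
  let Dz := chart_vec (Q := tot (dual_bundle E)) cz in
  let Dw := chart_vec (Q := tot E) cw in
  let bas a := delta_mx ord0 (lshift (rk E) a) in
  let fib k := delta_mx ord0 (rshift (dim M) k) in
  [/\ lsubmx w = lsubmx z,
      forall k, rsubmx w ord0 k = be (Dz (fib k)),
      forall a, ga (Dw (bas a)) = - be (Dz (bas a)) &
      forall k, ga (Dw (fib k)) = rsubmx z ord0 k].

(* dT is the complete lift with respect to Lam; its component of degree k is dT k. *)
Definition complete_lift (E : vbundle M) (Lam : tensor_field (tot (dual_bundle E)) 2)
    (dT : forall k, tensor_section E k -> tensor_field (tot E) k) : Prop :=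
  [/\ (forall k a (A B : tensor_section E k) y t,
         dT k (tsection_lin a A B) y t = a * dT k A y t + dT k B y t),
      (forall k l (A : tensor_section E k) (B : tensor_section E l) y t,
         dT (k + l)%N (tsection_prod A B) y t =
           tensor_prod (dT k A y) (vlift (B (projT1 y))) t +
           tensor_prod (vlift (A (projT1 y))) (dT l B y) t),
      (forall f y t, dT 0%N (tsection0 E f) y t = iota_bundle (dLam Lam f) y) &
      (forall X c i z w cz cw be ga, @canonical_iso E c i z w cz cw be ga ->
         dT 1%N (tsection1 X) _ (fun=> ga) = be (ham Lam (iota_dual X) _))].

End PreLie.

(* Main.v *)
(* Both sides of each identity obey the same Leibniz rule when P is multiplied by a
   function, so it suffices to expand P. Let eps_i be the sections of E obtained by
   cutting off a local frame near x: then phi P = sum_ij c_ij eps_i (x) eps_j holds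
   globally, where phi is a cut-off function with phi(x) = 1 that every derivation at
   x kills, so that P and phi P have the same complete lift over x. This reduces
   d_T(P) to the vector fields d_T(eps_i). The isomorphism from T^*E^* to T^*E takes
   d(iota Y - <Y, mu> - f) at mu(x) to d(iota mu + f) at Y(x), which gives
     d_T(X)(iota mu) = iota(L_X mu)   and   d_T(X)(f) = alpha(X)(f).
   The resulting formula for {iota mu, iota nu} shows that this function is fibrewise
   linear, and the pre-Lie algebroid axioms hold for every linear bivector field. *)
From HB Require Import structures.
From mathcomp Require Import all_boot all_order all_algebra.
From mathcomp Require Import boolp classical_sets functions reals.
From mathcomp Require Import interval_inference topology normedtype landau derive.
From mathcomp Require Import sequences realfun exp ring.
Require Import Defs.
Import Order.TTheory GRing.Theory Num.Theory.
Import numFieldNormedType.Exports.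

Set Implicit Arguments.
Unset Strict Implicit.
Unset Printing Implicit Defensive.

Local Open Scope classical_set_scope.
Local Open Scope ring_scope.

(** * A smooth bump function *)

Section Flat.
Variable R : realType.
Implicit Types (n : nat) (t : R).

(** The factors [t^-1 ^+ n] make the family stable under differentiation up to linear combinations,
    so that smoothness is proved by one induction on the order for all [n] at once. *)
Definition flat n t : R := if 0 < t then t^-1 ^+ n * expR (- t^-1) else 0.

(** The term of order [n.+2] of the exponential series bounds [expR t^-1] from below. The quadratic
    decay at 0 makes the derivative vanish there. *)
Lemma flat_le n t : `|flat n t| <= n.+2`!%:R * t ^+ 2.
Proof.
rewrite /flat; case: ltP => t0; last by rewrite normr0 mulr_ge0// sqr_ge0.
have ti : 0 < t^-1 by rewrite invr_gt0.
rewrite ger0_norm; last by rewrite mulr_ge0 ?expR_ge0// exprn_ge0// ltW.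
rewrite expRN ler_pdivrMr ?expR_gt0//.
have H := expR_ge1Dxn n.+1 (ltW ti).
have f0 : 0 < n.+2`!%:R :> R by rewrite ltr0n fact_gt0.
have -> : t^-1 ^+ n = n.+2`!%:R * t ^+ 2 * (t^-1 ^+ n.+2 / n.+2`!%:R).
  by rewrite !exprVn !exprS; field; rewrite expf_neq0 ?gt_eqF.
rewrite ler_pM2l; last by rewrite mulr_gt0// exprn_gt0.
by apply: le_trans H; rewrite lerDr.
Qed.

Lemma is_derive_flat n t :
  is_derive t 1 (flat n) (flat n.+2 t - n%:R * flat n.+1 t).
Proof.
have [t0|t0|->] := ltgtP t 0.
- have -> : flat n.+2 t - n%:R * flat n.+1 t = 0.
    by rewrite /flat ltNge ltW//= mulr0 subr0.
  apply: (near_eq_is_derive (f := cst 0)).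
  near=> u; rewrite /flat ltNge ltW//=; near: u.
  exact: lt_nbhsl.
- have tn0 : t != 0 by rewrite gt_eqF.
  apply: (near_eq_is_derive
    (f := (fun u : R => u^-1) ^+ n * (fun u => expR (- u^-1)))).
    near=> u; rewrite /flat.
    have -> : 0 < u by near: u; exact: lt_nbhsr.
    by rewrite !fctE.
  have dV : is_derive t 1 (fun u : R => u^-1) (- t ^- 2).
    by apply: is_derive_eq; [exact: is_deriveV|rewrite scaler1].
  have dE := @is_derive1_comp _ expR (- (fun u : R => u^-1)) _ _ _
    (is_derive_expR (- t^-1)) (is_deriveN dV).
  have dM := is_deriveM (is_deriveX n dV) dE.
  apply: is_derive_eq dM _.
  rewrite /flat t0 !fctE /GRing.scale /= opprK.
  case: n => [|n]; rewrite ?mulr0n !exprS ?mul0r ?expr0; first by field.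
  by rewrite /= !exprVn; field; rewrite expf_neq0.
- have -> : flat n.+2 0 - n%:R * flat n.+1 0 = 0 :> R.
    by rewrite /flat ltxx mulr0 subr0.
  (* By [flat_le] the difference quotient at 0 is at most (n+2)! |h| in absolute value. *)
  have cv : h^-1 *: ((flat n \o shift 0) (h *: 1) - flat n 0) @[h --> 0^'] --> (0 : R).
    apply/cvgr0Pnorm_le => _/posnumP[e].
    near=> h; rewrite /= addr0 [h *: 1]mulr1 {2}/flat ltxx subr0.
    have h0 : h != 0 by near: h; exact: nbhs_dnbhs_neq.
    rewrite normrM normfV ler_pdivrMl ?normr_gt0//.
    apply: le_trans (flat_le n h) _.
    rewrite -[h ^+ 2]ger0_norm ?sqr_ge0// normrX expr2 mulrCA ler_wpM2l//.
    rewrite -ler_pdivlMl ?ltr0n ?fact_gt0//; near: h; apply: dnbhs0_le.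
    by rewrite mulr_gt0// invr_gt0 ltr0n fact_gt0.
  by apply: DeriveDef; [apply/cvg_ex; exists 0|apply/cvg_lim].
Unshelve. all: by end_near. Qed.
End Flat.

(** * Composites and reciprocals of C^k functions *)

Section CkComposition.
Variable R : realType.

Lemma coord_differentiable (V : normedModType R) m (g : V -> 'rV[R]_m) x :
  (forall a, differentiable (fun y => g y ord0 a) x) -> differentiable g x.
Proof.
move=> dg; have -> : g = \sum_a (fun y => g y ord0 a *: (delta_mx ord0 a : 'rV[R]_m)).
  by apply/funext => y; rewrite fct_sumE -row_sum_delta.
by apply: differentiable_sum => a; apply: differentiableZl.
Qed.

Lemma coord_continuous_at (V : normedModType R) m (g : V -> 'rV[R]_m) x :
  (forall a, {for x, continuous (fun y => g y ord0 a)}) -> {for x, continuous g}.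
Proof.
move=> cg; have -> : g = \sum_a (fun y => g y ord0 a *: (delta_mx ord0 a : 'rV[R]_m)).
  by apply/funext => y; rewrite fct_sumE -row_sum_delta.
elim/big_ind: _ => [|f h cf ch|a _]; first exact: cst_continuous.
  exact: continuousD.
by apply: continuousZr_tmp; apply: cg.
Qed.

(** By the chain rule a directional derivative of [f \o g] is a sum of products of partial
    derivatives of [f], taken along [g], with derivatives of the coordinates of [g]; the induction
    hypothesis and [CkM] apply to these. *)
Lemma Ck_comp (V : normedModType R) m k (W : set V) (O : set 'rV[R]_m)
    (f : 'rV[R]_m -> R) (g : V -> 'rV[R]_m) :
  open W -> (forall x, W x -> O (g x)) ->
  (forall a, Ck k W (fun x => g x ord0 a)) -> Ck k O f -> Ck k W (f \o g).
Proof.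
move=> oW WO; elim: k f => [|k IHk] f cg.
  move=> cf x Wx; apply: continuous_comp; last by apply/cf/WO.
  by apply: coord_continuous_at => a; apply: cg.
move=> [df Df].
have dg x : W x -> differentiable g x.
  by move=> Wx; apply: coord_differentiable => a; have [+ _] := cg a; apply.
split=> [x Wx|v].
  by apply: differentiable_comp; [apply: dg|apply/df/WO].
have E x : W x -> \sum_a ('D_(delta_mx ord0 a) f \o g) x *
    'D_v (fun y => g y ord0 a) x = 'D_v (f \o g) x.
  move=> Wx; have dgx := dg x Wx; have dfx := df _ (WO _ Wx).
  rewrite [RHS]deriveE; last exact: differentiable_comp.
  rewrite diff_comp//= -(deriveE v dgx).
  rewrite [X in 'd f _ X]row_sum_delta linear_sum; apply: eq_bigr => a _.
  rewrite linearZ /= mulrC -deriveE// derive_mx ?mxE//.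
  exact: diff_derivable.
apply: (Ck_ext oW E); apply: Ck_sum => // a; apply: CkM => //.
  by apply: IHk => [b|]; [exact/Ck_pred/cg|exact: Df].
by have [_] := cg a; apply.
Qed.

Lemma CkV (V : normedModType R) k (W : set V) (f : V -> R) : open W ->
  (forall x, W x -> f x != 0) -> Ck k W f -> Ck k W (fun x => (f x)^-1).
Proof.
move=> oW f0; elim: k => [|k IHk] Cf.
  by move=> x Wx; apply: continuousV; [apply: f0|apply: Cf].
have [df Df] := Cf; split=> [x Wx|v].
  by apply: differentiableV; [apply: df|apply: f0].
have C := IHk (Ck_pred Cf).
apply: (@Ck_ext _ _ _ _ (cst (-1) * ((fun x => (f x)^-1) * (fun x => (f x)^-1)) *
    'D_v f)) => // [x Wx|].
  rewrite deriveV; [|exact: f0|exact/diff_derivable/df].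
  by rewrite !fctE /cst /GRing.scale /= mulN1r -invrM ?unitfE ?f0// expr2.
apply: CkM => //; last exact: Df.
apply: CkM => //; [exact: Ck_cst|exact: CkM].
Qed.

(** The induction is uniform in [n], since the derivative of [flat n] involves [flat n.+1] and
    [flat n.+2]. *)
Lemma Ck_flat (V : normedModType R) k n (W : set V) (s : V -> R) : open W ->
  Ck k W s -> Ck k W (flat n \o s).
Proof.
move=> oW; elim: k n => [|k IHk] n Cs.
  move=> x Wx; apply: continuous_comp; first exact: Cs.
  apply: differentiable_continuous; apply/derivable1_diffP.
  by have [] := is_derive_flat n (s x).
have df t : differentiable (flat n : R -> R) t.
  by apply/derivable1_diffP; have [] := is_derive_flat n t.
have [ds Ds] := Cs; split=> [x Wx|v].
  by apply: differentiable_comp => //; apply: ds.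
apply: (@Ck_ext _ _ _ _ (((flat n.+2 \o s) + cst (- n%:R) * (flat n.+1 \o s)) *
    'D_v s)) => // [x Wx|]; last first.
  apply: CkM => //; last exact: Ds.
  apply: CkD => //; first exact: IHk (Ck_pred Cs).
  by apply: CkM => //; [exact: Ck_cst|exact: IHk (Ck_pred Cs)].
have dsx := ds x Wx; have dfx := df (s x).
have dfs : differentiable (flat n \o s) x by apply: differentiable_comp.
rewrite [RHS](deriveE v dfs) diff_comp//= -(deriveE v dsx).
rewrite diff1E// derive1E (@derive_val _ _ _ _ _ _ _ (is_derive_flat n (s x))).
by rewrite !fctE /cst /= mulNr mulrC.
Qed.

End CkComposition.

(** * Cut-off functions on a manifold *)

Section SmoothOn.
Variables (R : realType) (Q : atlas R).
Implicit Types (W O : set Q) (f g : Q -> R).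

Lemma smooth_sub W O f : W `<=` O -> smooth_on O f -> smooth_on W f.
Proof. by move=> sWO sf c k; apply: Ck_sub (sf c k) => u [cu /sWO]. Qed.

Lemma smooth_localW W f :
  (forall x, W x -> exists2 O : set Q, O x & smooth_on O f) -> smooth_on W f.
Proof.
move=> H c k; apply: Ck_local => u [cu /H[U Uu sU]].
by exists (cdom c `&` cpar c @^-1` U) => //; apply: sU.
Qed.

Lemma smoothV W f : open_in W -> (forall x, W x -> f x != 0) ->
  smooth_on W f -> smooth_on W (fun x => (f x)^-1).
Proof. by move=> oW f0 sf c k; apply: CkV (sf c k) => // u [_ /f0]. Qed.

Lemma open_in_neq0 (f : cinf Q) : open_in [set x | f x != 0].
Proof.
move=> c; rewrite openE => u -[cu fu].
have cf : {for u, continuous (f \o cpar c)}.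
  exact: (cinf_smooth f c 0%N u (conj cu I)).
near=> w; split; first by near: w; apply: open_nbhs_nbhs; split=> //; exact: cdom_open.
near: w; apply: (cf [set r | r != 0]).
by apply: open_nbhs_nbhs; split=> //; exact: open_neq.
Unshelve. all: by end_near. Qed.

End SmoothOn.

Section TangentVectors.
Variables (R : realType) (Q : atlas R) (q : Q) (v : tangent q).
Implicit Types (f g : cinf Q).

Lemma tangent_lin a f g : v (a *: f + g) = a * v f + v g.
Proof. by have /derivationP[H _] := tangent_funP v; apply: H. Qed.

Lemma tangentM f g : v (f * g) = f q * v g + g q * v f.
Proof. by have /derivationP[_ H] := tangent_funP v; apply: H. Qed.

HB.instance Definition _ :=
  GRing.isLinear.Build R (cinf Q) R^o *:%R (tangent_fun v) tangent_lin.

Lemma tangent_scalar a : v (a *: (1 : cinf Q)) = 0.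
Proof.
have := tangentM 1 1; rewrite mulr1 -[cinf_fun 1 q]/(1 : R) mul1r.
move=> /eqP; rewrite -subr_eq subrr eq_sym => /eqP v1.
by rewrite linearZ /= v1 scaler0.
Qed.

End TangentVectors.

Section Bump.
Variables (R : realType) (M : manifold R).

(** Hausdorff separation treats one point of [K] at a time; compactness, in its near-covering form,
    makes the neighbourhood of [w] uniform over [K]. Functions supported in [K] can then be extended
    by zero. *)
Lemma compact_image_closed (c : chart M) (K : set 'rV[R]_(dim M)) :
  K `<=` cdom c -> compact K -> open_in (~` (cpar c @` K)).
Proof.
move=> Kc /compact_near_coveringP cK d; rewrite openE => w -[dw nKw].
have H : \forall v \near w, K `<=` (fun u => cpar c u <> cpar d v).
  apply: (cK _ (nbhs w) (fun v u => cpar c u <> cpar d v) _) => u Ku.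
  have cdE : cpar c u <> cpar d w by move=> E; apply: nKw; exists u.
  have [U [V [oU oV Uu Vw UV]]] := hausdorff_manifold cdE.
  exists (cdom c `&` cpar c @^-1` U, cdom d `&` cpar d @^-1` V).
    split; apply: open_nbhs_nbhs; split=> //; [exact: oU|split=> //; exact: Kc|exact: oV].
  move=> [u' v] /= [[_ Uu'] [_ Vv]] E; have : (U `&` V) (cpar d v).
    by split=> //; rewrite -E.
  by rewrite UV.
near=> v; split; first by near: v; apply: open_nbhs_nbhs; split=> //; exact: cdom_open.
by move=> [u Ku]; apply: (near H v).
Unshelve. all: by end_near. Qed.

(** The function lives on a chart ball inside [W]. Its support is controlled by an open set [O]
    where it vanishes and which covers [M] together with [W]: the smoothness of its product with
    data given on [W] is then checked on the two sets separately. *)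
Lemma exists_bump (W : set M) x0 : open_in W -> W x0 ->
  exists2 chi : cinf M, chi x0 = 1 & exists O : set M,
    [/\ open_in O, forall x, O x -> chi x = 0 & forall x, W x \/ O x].
Proof.
move=> oW Wx0; have [c [u0 [cu0 x0E]]] := cpar_cover x0.
have oA := oW c; set A := _ `&` _ in oA.
have Au0 : A u0 by split=> //=; rewrite x0E.
have : nbhs u0 A by apply: open_nbhs_nbhs.
move=> /nbhs_closedballP[p rA].
have r0 : 0 < p%:num by []; set r := p%:num in rA r0.
set K := closed_ball u0 r in rA.
have cK : compact K.
  apply: bounded_closed_compact; last exact: closed_ball_closed.
  exists (`|u0| + r); split; [exact: num_real|move=> m mr y].
  rewrite /K closed_ballE// /closed_ball_ /= => yr.
  apply: le_trans (ltW mr); rewrite -[y](subKr u0).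
  by apply: le_trans (ler_normB _ _) _; rewrite lerD2l.
have Kc : K `<=` cdom c by move=> u /rA[].
(* The squared Euclidean distance is smooth, whereas [K] is a ball for the maximum norm. The
   Euclidean ball of radius [r] lies in [K], so [s] vanishes off [K]. *)
pose sq (u : 'rV[R]_(dim M)) :=
  \sum_i (u ord0 i - u0 ord0 i) * (u ord0 i - u0 ord0 i).
pose s u := (flat 0 (r * r))^-1 * flat 0 (r * r - sq u).
have flat0 : 0 < flat 0 (r * r).
  by rewrite /flat mulr_gt0// expr0 mul1r expR_gt0.
have sK u : ~ K u -> s u = 0.
  move=> nKu; rewrite /s {2}/flat; case: ltP; rewrite ?mulr0// => sr.
  exfalso; apply: nKu; rewrite /K closed_ballE// /closed_ball_ /=.
  rewrite [leLHS]mx_normrE bigmax_le ?(ltW r0)//= => -[i j] _ /=; rewrite (ord1 i) !mxE.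
  rewrite -ler_sqr ?nnegrE ?(ltW r0)// real_normK ?num_real//.
  move: sr; rewrite subr_gt0 -expr2 => /ltW; apply: le_trans.
  rewrite /sq (bigD1 j)//= -expr2 -sqrrN opprB lerDl.
  by apply: sumr_ge0 => k _; rewrite -expr2 sqr_ge0.
have su0 : s u0 = 1.
  rewrite /s /sq big1 ?subr0 ?mulVf ?gt_eqF// => i _.
  by rewrite subrr mul0r.
have Cs k : Ck k setT s.
  apply: (@CkM _ _ _ _ (cst _) (flat 0 \o _)); [exact: openT|exact: Ck_cst|].
  apply: Ck_flat; first exact: openT.
  have -> : (fun u => r * r - sq u) = cst (r * r) + cst (-1) * sq.
    by apply/funext => u; rewrite !fctE mulN1r.
  have oT := @openT 'rV[R]_(dim M).
  apply: CkD => //; first exact: Ck_cst.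
  apply: CkM => //; first exact: Ck_cst.
  apply: Ck_sum => // i.
  have C : Ck k setT (fun u : 'rV[R]_(dim M) => u ord0 i - u0 ord0 i).
    by apply: (@CkD _ _ _ _ _ (cst _)) => //; [exact: Ck_coord|exact: Ck_cst].
  exact: CkM.
(* Injectivity of [cpar c] on [cdom c] makes the value independent of the chosen preimage. *)
pose chi x : R := if pselect (exists u, cdom c u /\ cpar c u = x) is left h
  then s (projT1 (cid h)) else 0.
have chiE u : cdom c u -> chi (cpar c u) = s u.
  move=> cu; rewrite /chi; case: pselect => [h|]; last by case; exists u.
  by case: cid => u' /= [cu' /cpar_inj]; rewrite !inE => ->.
have oO := compact_image_closed Kc cK; set O := ~` _ in oO.
have chi0 x : O x -> chi x = 0.
  move=> Ox; rewrite /chi; case: pselect => // h.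
  by case: cid => u /= [cu uE]; apply: sK => Ku; apply: Ox; exists u.
have schi : chi \in smooth.
  apply/smoothP/smooth_local => x; have [Ox|nOx] := pselect (O x).
    exists O => //; apply: (@smooth_ext _ _ _ (cst 0)) => //; last exact: smooth_cst.
    by move=> y /chi0.
  (* Outside [O] the point lies in the image of [c], where [chi] is [s] composed with a change of
     coordinates. *)
  have /contrapT[u Ku <-] := nOx.
  exists (cpar c @` cdom c); first by exists u => //; exact: Kc.
  move=> d k; have /= := cpar_change d c; set D := _ `&` _ => -[oD [g [gE Cg]]].
  apply: (@Ck_ext _ _ _ _ (s \o g)) => // [w Dw|].
    by have [cg gw] := gE w Dw; rewrite /= -gw chiE.
  by apply: (Ck_comp (O := setT)) => // a; apply: Cg.
exists (Cinf schi) => /=; first by rewrite -x0E chiE.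
exists O; split=> // x; have [Ox|/contrapT[u Ku <-]] := pselect (O x); first by right.
by left; have [] := rA u Ku.
Qed.

(* 3 t^2 - 2 t^3 has a critical point with value 1 at t = 1. *)
Lemma exists_flat_bump (W : set M) x0 : open_in W -> W x0 ->
  exists chi : cinf M,
    [/\ chi x0 = 1, forall v : tangent x0, v chi = 0 & exists O : set M,
    [/\ open_in O, forall x, O x -> chi x = 0 & forall x, W x \/ O x]].
Proof.
move=> oW Wx0; have [chi chi1 [U [oU U0 WU]]] := exists_bump oW Wx0.
exists ((3%:R : R) *: (chi * chi) - (2%:R : R) *: (chi * chi * chi)); split.
- rewrite -[LHS]/(3%:R * (chi x0 * chi x0) - 2%:R * (chi x0 * chi x0 * chi x0)) chi1.
  by ring.
- move=> v; rewrite linearB !linearZ /= !tangentM.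
  rewrite -[(chi * chi) x0]/(chi x0 * chi x0) chi1 /GRing.scale /=.
  by ring.
exists U; split=> // x /U0 H.
by rewrite -[LHS]/(3%:R * (chi x * chi x) - 2%:R * (chi x * chi x * chi x)) H; ring.
Qed.

End Bump.

(** * Global frames *)

Section Sections.
Variables (R : realType) (M : manifold R).

Lemma cinf_ext (Q : atlas R) (f g : cinf Q) : f =1 g -> f = g.
Proof. by move=> fg; apply/val_inj/funext. Qed.

Lemma cinfN (Q : atlas R) (f : cinf Q) x : (- f : cinf Q) x = - f x.
Proof. by []. Qed.

Lemma cinfM (Q : atlas R) (f g : cinf Q) x : (f * g : cinf Q) x = f x * g x.
Proof. by []. Qed.

Lemma cinf_sumE (Q : atlas R) I (r : seq I) (F : I -> cinf Q) x :
  (\sum_(s <- r) F s : cinf Q) x = \sum_(s <- r) F s x.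
Proof. by elim/big_ind2: _ => // a f b g <- <-. Qed.

Lemma section_linE (F : vbundle M) f (X Y : section F) x :
  section_lin f X Y x = f x *: X x + Y x.
Proof. by []. Qed.

Lemma section_ext (F : vbundle M) (X Y : section F) : (forall x, X x = Y x) -> X = Y.
Proof.
case: X Y => [X PX] [Y PY] /= XY; have XYE : X = Y by apply: functional_extensionality_dep.
by subst Y; congr MkSection; apply: Prop_irrelevance.
Qed.

Section Comb.
Variables (F : vbundle M) (n : nat) (g : 'I_n -> cinf M) (X : 'I_n -> section F).

Lemma section_comb_subproof (i : triv F) k :
  smooth_on (tdom i) (fun x => tco i x (\sum_s g s x *: X s x) ord0 k).
Proof.
have oi : open_in (tdom i) by apply: tdom_open.
apply: (@smooth_ext _ _ _ (fun x => \sum_s g s x * tco i x (X s x) ord0 k)) => //.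
  by move=> x _; rewrite linear_sum summxE; apply: eq_bigr => s _; rewrite linearZ mxE.
apply: smooth_sum => // s; apply: smoothM => //; last exact: secP.
exact: smooth_sub (@subsetT _ _) (cinf_smooth (g s)).
Qed.

Definition section_comb : section F := MkSection section_comb_subproof.

End Comb.

(** [D f Y] may contain derivatives of [f], so this also covers Lie derivatives, which are not
    tensorial in the vector field. Subtracting the first term from [Z] gives a section whose
    expansion is the tail. *)
Lemma section_sum_ind (F : vbundle M) (V : zmodType) (T : section F -> V)
    (D : cinf M -> section F -> V) I (r : seq I) (g : I -> cinf M)
    (X : I -> section F) (Z : section F) :
  T (section0 F) = 0 ->
  (forall f Y Y', T (section_lin f Y Y') = D f Y + T Y') ->
  (forall x, Z x = \sum_(s <- r) g s x *: X s x) ->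
  T Z = \sum_(s <- r) D (g s) (X s).
Proof.
move=> T0 TD; elim: r Z => [|s r IHr] Z ZE.
  rewrite big_nil -[RHS]T0; congr T; apply: section_ext => x.
  by rewrite ZE big_nil.
rewrite big_cons -(IHr (section_lin (- g s) (X s) Z)).
  by rewrite -TD; congr T; apply: section_ext => x; rewrite !section_linE cinfN scaleNr addNKr.
by move=> x; rewrite section_linE ZE big_cons cinfN scaleNr addKr.
Qed.

Lemma smooth_comp_section (G : vbundle M) (h : cinf (tot G)) (V : section G) :
  (fun x => h (existT _ x (V x))) \in smooth.
Proof.
apply/smoothP/smooth_local => x; have [i ix] := tdom_cover G x; exists (tdom i) => // c k.
have oi : open (cdom c `&` cpar c @^-1` tdom i) by apply: tdom_open.
pose g u : 'rV[R]_(dim M + rk G) := row_mx u (tco i (cpar c u) (V (cpar c u))).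
apply: (@Ck_ext _ _ _ _ ((h \o cpar ((c, i) : chart (tot G))) \o g)) => // [u [_ iu]|].
  by rewrite /= row_mxKl row_mxKr tcoK.
apply: (Ck_comp (O := cdom ((c, i) : chart (tot G)) `&` cpar _ @^-1` setT)) => //.
- by move=> u [cu iu]; split=> //=; rewrite row_mxKl.
- move=> a; case: (@split_ordP (dim M) (rk G) a) => b ->.
    have -> : (fun u => g u ord0 (lshift (rk G) b)) = (fun u => u ord0 b).
      by apply/funext => u; rewrite row_mxEl.
    exact: Ck_coord.
  have -> : (fun u => g u ord0 (rshift (dim M) b)) =
      (fun y => tco i y (V y) ord0 b) \o cpar c.
    by apply/funext => u; rewrite row_mxEr.
  exact: secP.
exact: cinf_smooth.
Qed.

(** Outside [tdom i] the values of [tpar i] are junk, but such points lie in the open set [W], where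
    [chi] is zero. *)
Lemma bump_section (F : vbundle M) (i : triv F) (chi : cinf M) (W : set M)
    (v : 'rV[R]_(rk F)) :
  open_in W -> (forall x, W x -> chi x = 0) -> (forall x, tdom i x \/ W x) ->
  exists X : section F, forall x, X x = chi x *: tpar i x v.
Proof.
move=> oW chi0 iW.
suff P (j : triv F) k :
    smooth_on (tdom j) (fun x => tco j x (chi x *: tpar i x v) ord0 k).
  by exists (MkSection P).
have -> : (fun x => tco j x (chi x *: tpar i x v) ord0 k) =
    (fun x => chi x * tco j x (tpar i x v) ord0 k).
  by apply/funext => x; rewrite linearZ mxE.
apply: smooth_localW => x jx; case: (iW x) => [ix|Wx].
  have oij : open_in (tdom i `&` tdom j) by apply: open_inI; apply: tdom_open.
  exists (tdom i `&` tdom j) => //; apply: smoothM => //; last exact: tchange.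
  exact: smooth_sub (@subsetT _ _) (cinf_smooth chi).
exists W => //; apply: (@smooth_ext _ _ _ (cst 0)) => // [y /chi0 ->|].
  by rewrite mul0r.
exact: smooth_cst.
Qed.

End Sections.

(** * Vector bundles in duality and the representation of tensorial maps *)

Section DualPairing.
Variables (R : realType) (M : manifold R).

(* Abstracts what [E] and its dual have in common, so that statements about the
   pair apply in both orders. The frames replace local ones: [phi]
   is a cut-off function, and derivations at [x0] do not see it. *)
Record dual_pairing (F G : vbundle M) (ev : forall x, F x -> G x -> R) : Prop := {
  ev_linl : forall x a u u' v, ev x (a *: u + u') v = a * ev x u v + ev x u' v;
  ev_linr : forall x a u v v', ev x u (a *: v + v') = a * ev x u v + ev x u v';
  ev_smooth : forall (X : section F) (V : section G),
    (fun x => ev x (X x) (V x)) \in smooth;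
  ev_frame : forall x0, exists (n : nat) (phi : cinf M)
    (eps : 'I_n -> section F) (th : 'I_n -> section G),
    [/\ phi x0 = 1, (forall v : tangent x0, v phi = 0),
        (forall x u, phi x *: u = \sum_k ev x u (th k x) *: eps k x) &
        (forall x v, phi x *: v = \sum_k ev x (eps k x) v *: th k x)] }.

Lemma dual_pairing_sym (F G : vbundle M) (ev : forall x, F x -> G x -> R) :
  dual_pairing ev -> dual_pairing (fun x v u => ev x u v).
Proof.
case=> ll lr sm fr; split=> // x0.
by have [n [phi [eps [th [? ? ? ?]]]]] := fr x0; exists n, phi, th, eps.
Qed.

(** A local frame and its dual frame are both multiplied by [chi]. Each term of an expansion carries
    this factor twice, whence [phi] is [chi * chi]. *)
Lemma dual_bundle_pairing (E : vbundle M) :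
  @dual_pairing E (dual_bundle E) (fun x e a => a e).
Proof.
split=> [x a u u' v|//|X V|x0]; first exact: linearP.
  exact: (cinf_funP (pairing X V)).
have [i ix0] := tdom_cover E x0.
have [chi [chi1 dchi [W [oW chi0 iW]]]] := exists_flat_bump (@tdom_open _ _ _ i) ix0.
have /choice[eps epsE] := fun k => bump_section (delta_mx ord0 k) oW chi0 iW.
have /choice[th thE] := fun k =>
  @bump_section _ _ (dual_bundle E) i chi W (delta_mx ord0 k) oW chi0 iW.
have frame x (u : E x) : (chi * chi) x *: u = \sum_k th k x u *: eps k x.
  rewrite cinfM.
  have [ix|Wx] := iW x; last first.
    rewrite chi0// mul0r scale0r big1 // => k _.
    by rewrite epsE chi0// scale0r scaler0.
  rewrite -[in LHS](tcoK ix u) [tco i x u]row_sum_delta linear_sum scaler_sumr.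
  apply: eq_bigr => k _; rewrite epsE thE linearZ /= !scalerA; congr (_ *: _).
  rewrite fctE /GRing.scale /= (bigD1 k)//= big1 ?addr0.
    by rewrite mxE !eqxx mul1r mulrAC.
  by move=> l lk; rewrite mxE (negPf lk) andbF mul0r.
exists (rk E), (chi * chi), eps, th; split=> //.
- by rewrite cinfM chi1 mulr1.
- by move=> v; rewrite tangentM !dchi !mulr0 addr0.
move=> x v; apply: val_inj; apply/funext => u /=.
(* The expansion of [v] is obtained by applying [v] to that of [u]. *)
transitivity (v ((chi * chi) x *: u)); first by rewrite linearZ.
rewrite frame linear_sum /=.
elim/big_ind2: _ => //= [a b c d -> ->//|k _].
by rewrite linearZ /= [RHS]mulrC.
Qed.

End DualPairing.

Section LinearForms.
Variables (R : realType) (V : lmodType R) (h : V -> R).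
Hypothesis hlin : forall a u v, h (a *: u + v) = a * h u + h v.

Lemma lin_form0 : h 0 = 0.
Proof.
have := hlin 1 0 0; rewrite scaler0 addr0 mul1r => /eqP.
by rewrite -subr_eq subrr eq_sym => /eqP.
Qed.

Lemma lin_formZ a u : h (a *: u) = a * h u.
Proof. by rewrite -[a *: u]addr0 hlin lin_form0 addr0. Qed.

Lemma lin_form_sum I (r : seq I) (a : I -> R) (u : I -> V) :
  h (\sum_(s <- r) a s *: u s) = \sum_(s <- r) a s * h (u s).
Proof.
elim: r => [|s r IHr]; first by rewrite !big_nil lin_form0.
by rewrite !big_cons hlin IHr.
Qed.

End LinearForms.

Section Representation.
Variables (R : realType) (M : manifold R) (F G : vbundle M).
Variables (ev : forall x, F x -> G x -> R) (dp : dual_pairing ev).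

Definition ev_cinf (X : section F) (V : section G) : cinf M := Cinf (ev_smooth dp X V).

Lemma ev_suml x I (r : seq I) (a : I -> R) (u : I -> F x) v :
  ev (\sum_(s <- r) a s *: u s) v = \sum_(s <- r) a s * ev (u s) v.
Proof. exact: (lin_form_sum (fun a u u' => ev_linl dp a u u' v)). Qed.

Lemma ev_scalel x a (u : F x) v : ev (a *: u) v = a * ev u v.
Proof. exact: (lin_formZ (fun a u u' => ev_linl dp a u u' v)). Qed.

Lemma ev_injr x (v v' : G x) : (forall X : section F, ev (X x) v = ev (X x) v') -> v = v'.
Proof.
move=> vv'; have [n [phi [eps [th [phi1 _ _ fr]]]]] := ev_frame dp x.
rewrite -[v]scale1r -[v']scale1r -phi1 !fr.
by apply: eq_bigr => k _; rewrite vv'.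
Qed.

Lemma section_through x (u : F x) : exists X : section F, X x = u.
Proof.
have [n [phi [eps [th [phi1 _ fr _]]]]] := ev_frame dp x.
exists (section_comb (fun k => ev u (th k x) *: (1 : cinf M)) eps) => /=.
rewrite -[RHS]scale1r -phi1 fr; apply: eq_bigr => k _; congr (_ *: _).
exact: mulr1.
Qed.

End Representation.

Section TensorialMaps.
Variables (R : realType) (M : manifold R) (F G : vbundle M).
Variables (ev : forall x, F x -> G x -> R) (dp : dual_pairing ev).

Lemma ev_sumr x I (r : seq I) (a : I -> R) (u : F x) (v : I -> G x) :
  ev u (\sum_(s <- r) a s *: v s) = \sum_(s <- r) a s * ev u (v s).
Proof. exact: (ev_suml (dual_pairing_sym dp)). Qed.

Lemma ev_scaler x a (u : F x) v : ev u (a *: v) = a * ev u v.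
Proof. exact: (ev_scalel (dual_pairing_sym dp)). Qed.

Lemma ev0r x (u : F x) : ev u 0 = 0.
Proof. exact: (lin_form0 (fun a v v' => ev_linr dp a u v v')). Qed.

(** Since [phi * T X] is the value of [T] on the product of [phi] and [X], which has a global
    expansion in the frame, [T] is represented up to the factor [phi] by the combination of the
    [th k] with coefficients [T (eps k)]. This gives the value at each point, and dividing by [phi]
    where it is nonzero gives smoothness. *)
Lemma tensorial_rep (T : section F -> cinf M) :
  (forall f X Y, T (section_lin f X Y) = f * T X + T Y) ->
  exists Z : section G, forall (X : section F) x, ev (X x) (Z x) = T X x.
Proof.
move=> TD; have T0 : T (section0 F) = 0.
  have := TD 1 (section0 F) (section0 F).
  have -> : section_lin 1 (section0 F) (section0 F) = section0 F.
    by apply: section_ext => x; rewrite section_linE scaler0 addr0.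
  by rewrite mul1r => /eqP; rewrite -subr_eq subrr eq_sym => /eqP.
have loc x0 : exists (phi : cinf M) (Z : section G), phi x0 = 1 /\
    forall (X : section F) x, ev (X x) (Z x) = phi x * T X x.
  have [n [phi [eps [th [phi1 _ fr _]]]]] := ev_frame dp x0.
  exists phi, (section_comb (T \o eps) th); split=> // X x.
  have := section_sum_ind (r := index_enum 'I_n)
    (g := fun k => ev_cinf dp X (th k)) (X := eps) T0 TD.
  move=> /(_ (section_lin phi X (section0 F))); rewrite TD T0 addr0.
  rewrite -cinfM => -> => [|y]; last by rewrite section_linE addr0 fr.
  rewrite /= ev_sumr cinf_sumE.
  by apply: eq_bigr => k _; rewrite cinfM mulrC.
pose zP x0 (z : G x0) := forall X : section F, ev (X x0) z = T X x0.
have zex x0 : exists z, zP x0 z.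
  have [phi [Z [phi1 ZE]]] := loc x0.
  by exists (Z x0) => X; rewrite ZE phi1 mul1r.
pose z x := projT1 (cid (zex x)); have zE x : zP x (z x) by apply: projT2 (cid (zex x)).
suff P (i : triv G) k : smooth_on (tdom i) (fun x => tco i x (z x) ord0 k).
  by exists (MkSection P) => X x; apply: zE.
apply: smooth_localW => x0 ix0; have [phi [Z [phi1 ZE]]] := loc x0.
have oW : open_in (tdom i `&` [set x | phi x != 0]).
  by apply: open_inI; [exact: tdom_open|exact: open_in_neq0].
exists (tdom i `&` [set x | phi x != 0]); first by split=> //=; rewrite phi1 oner_neq0.
apply: (@smooth_ext _ _ _ (fun x => (phi x)^-1 * tco i x (Z x) ord0 k)) => //.
  move=> x [_ phi0]; have -> : Z x = phi x *: z x.
    by apply: (ev_injr dp) => X; rewrite ZE -zE ev_scaler.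
  by rewrite linearZ mxE mulKf.
apply: smoothM => //.
  apply: smoothV => //; first by move=> x [].
  exact: smooth_sub (@subsetT _ _) (cinf_smooth phi).
by apply: smooth_sub (secP Z i k) => x [].
Qed.

End TensorialMaps.

Section FibrewiseLinear.
Variables (R : realType) (M : manifold R) (F G : vbundle M).
Variables (ev : forall x, F x -> G x -> R) (dp : dual_pairing ev).

Lemma ev_injl x (u u' : F x) : (forall V : section G, ev u (V x) = ev u' (V x)) -> u = u'.
Proof. exact: (ev_injr (dual_pairing_sym dp)). Qed.

(** Composing [h] with sections of [G] is linear over functions, so [tensorial_rep] applies with the
    roles of [F] and [G] exchanged. *)
Lemma fibrewise_rep (h : cinf (tot G)) : fibrewise_linear h ->
  exists Z : section F, forall x v, h (existT _ x v) = ev (Z x) v.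
Proof.
move=> hlin.
have TD f (V V' : section G) : Cinf (smooth_comp_section h (section_lin f V V')) =
    f * Cinf (smooth_comp_section h V) + Cinf (smooth_comp_section h V').
  by apply: cinf_ext => x; rewrite /= hlin.
have [Z ZE] := tensorial_rep (dual_pairing_sym dp) TD.
exists Z => x v; have [V <-] := section_through (dual_pairing_sym dp) v.
by rewrite ZE.
Qed.

End FibrewiseLinear.

(** * Linear bivectors and pre-Lie algebroids *)

Lemma theP (T : Type) (t0 : T) (P : T -> Prop) : (exists t, P t) -> P (the t0 P).
Proof.
by move=> exP; rewrite /the; case: pselect => // h; apply: projT2 (cid h).
Qed.

Section Brackets.
Variables (R : realType) (Q : atlas R) (B : tensor_field Q 2).
Hypothesis skewB : bivector B.
Implicit Types f g h : cinf Q.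

Lemma pbracketC f g : pbracket B f g = - pbracket B g f.
Proof. by apply: cinf_ext => q; apply: skewB. Qed.

Lemma pbracketDl f g h : pbracket B (f + g) h = pbracket B f h + pbracket B g h.
Proof. by apply: cinf_ext => q; apply: (raddfD (tangent_fun (ham B h q))). Qed.

Lemma pbracketZl a f h : pbracket B (a *: f) h = a *: pbracket B f h.
Proof.
apply: cinf_ext => q; have := tangent_lin (ham B h q) a f 0.
by rewrite addr0 raddf0 addr0.
Qed.

Lemma pbracketMl f g h : pbracket B (f * g) h = f * pbracket B g h + g * pbracket B f h.
Proof. by apply: cinf_ext => q; apply: (tangentM (ham B h q)). Qed.

Lemma pbracketDr f g h : pbracket B f (g + h) = pbracket B f g + pbracket B f h.
Proof. by rewrite pbracketC pbracketDl opprD -!(pbracketC f). Qed.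

Lemma pbracketZr a f h : pbracket B f (a *: h) = a *: pbracket B f h.
Proof. by rewrite pbracketC pbracketZl -scalerN -(pbracketC f). Qed.

Lemma pbracketMr f g h : pbracket B f (g * h) = g * pbracket B f h + h * pbracket B f g.
Proof. by rewrite pbracketC pbracketMl opprD -!mulrN -!(pbracketC f). Qed.

End Brackets.

Section LinearBivector.
Variables (R : realType) (M : manifold R) (F G : vbundle M).
Variables (ev : forall x, F x -> G x -> R) (dp : dual_pairing ev).
Variable (io : section F -> cinf (tot G)).
Hypothesis ioE : forall (X : section F) x v, io X (existT _ x v) = ev (X x) v.
Variable B : tensor_field (tot G) 2.
Hypothesis linB : linear_bivector io B.

Let skewB : bivector B. Proof. by case: linB. Qed.
Let evlinl := ev_linl dp.
Let evlinr := ev_linr dp.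

Lemma pull_lin a (f g : cinf M) : pull G (a *: f + g) = a *: pull G f + pull G g.
Proof. exact: cinf_ext. Qed.

Lemma pullM (f g : cinf M) : pull G (f * g) = pull G f * pull G g.
Proof. exact: cinf_ext. Qed.

Lemma io_lin f X Y : io (section_lin f X Y) = pull G f * io X + io Y.
Proof.
apply: cinf_ext => -[x v]; rewrite ioE section_linE evlinl.
by rewrite -[RHS]/(f x * io X (existT _ x v) + io Y (existT _ x v)) !ioE.
Qed.

Lemma bracketE X Y : io (bracket io B X Y) = pbracket B (io X) (io Y).
Proof.
apply: (@theP _ _ (fun Z => io Z = _)).
have [Z ZE] := fibrewise_rep dp (linB.2 X Y).
by exists Z; apply: cinf_ext => -[x v]; rewrite ioE ZE.
Qed.

(** This serves to reach the zero vector in [pbracket_pull_basic]. *)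
Lemma fibre_line_continuous (h : cinf (tot G)) x (v : G x) :
  {for 0, continuous (fun s : R => h (existT _ x (s *: v)))}.
Proof.
have [c [u [cu xE]]] := cpar_cover x; have [i ix] := tdom_cover G x.
subst x; set w := tco i _ v.
pose z (s : R) : 'rV[R]_(dim M + rk G) := row_mx u 0 + s *: row_mx 0 w.
have hE s : h (existT _ (cpar c u) (s *: v)) = (h \o cpar ((c, i) : chart (tot G))) (z s).
  by rewrite /z /= scale_row_mx scaler0 add_row_mx addr0 add0r row_mxKl row_mxKr linearZ /= tcoK.
have -> : (fun s : R => h (existT _ (cpar c u) (s *: v))) =
    (h \o cpar ((c, i) : chart (tot G))) \o z by apply/funext.
apply: continuous_comp.
  apply: continuousD; first exact: cst_continuous.
  by apply: continuousZr_tmp; exact: cvg_id.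
apply: (cinf_smooth h (c, i) 0%N); split => //=.
by rewrite /z scale0r addr0 row_mxKl.
Qed.

(** In {X, fY} = f{X, Y} + <Y, .>{X, f} the brackets of linear functions are fibrewise linear, hence
    so is <Y, .>{X, f}. Comparing its values at [s *: v] and [v], for [Y] with <Y, v> nonzero, shows
    that {X, f} is constant for [s] nonzero; continuity gives [s = 0]. *)
Lemma pbracket_pull_basic X f x (v : G x) :
  pbracket B (io X) (pull G f) (existT _ x v) =
  pbracket B (io X) (pull G f) (existT _ x (0 : G x)).
Proof.
set h := pbracket B (io X) (pull G f).
have [->//|v0] := pselect (v = 0).
have [Y Yv] : exists Y : section F, ev (Y x) v != 0.
  apply: contrapT => nY; apply: v0; apply: (ev_injr dp) => Y.
  have -> : ev (Y x) v = 0.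
    by apply/eqP/contraT => Yv; case: nY; exists Y.
  by rewrite (ev0r dp).
have lin s : ev (Y x) (s *: v) * h (existT _ x (s *: v)) =
    s * (ev (Y x) v * h (existT _ x v)).
  have E w : ev (Y x) w * h (existT _ x w) =
      pbracket B (io X) (io (section_lin f Y (section0 F))) (existT _ x w) -
      f x * pbracket B (io X) (io Y) (existT _ x w) -
      pbracket B (io X) (io (section0 F)) (existT _ x w).
    rewrite io_lin pbracketDr// pbracketMr// -ioE.
    rewrite -[X in _ = X - _ - _]/(f x * pbracket B (io X) (io Y) (existT _ x w) +
      io Y (existT _ x w) * h (existT _ x w) +
      pbracket B (io X) (io (section0 F)) (existT _ x w)).
    ring.
  rewrite !E !(lin_formZ (linB.2 _ _ x)).
  ring.
have hs s : s != 0 -> h (existT _ x (s *: v)) = h (existT _ x v).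
  move=> s0; have := lin s; rewrite (ev_scaler dp) -mulrA => /(mulfI s0).
  exact: mulfI.
have c1 := (continuous_withinNx _ _).1 (@fibre_line_continuous h x v).
have c2 : h (existT _ x (s *: v)) @[s --> (0 : R)^'] --> h (existT _ x v).
  apply: cvg_trans (near_eq_cvg _) (cvg_cst (h (existT _ x v))).
  near=> s; rewrite hs//; near: s; exact: nbhs_dnbhs_neq.
by rewrite (norm_cvg_unique c2 c1) scale0r.
Unshelve. all: by end_near. Qed.

(** On the zero section [io X] vanishes, which removes the term with {g, f} from {gX + Y, f}; the
    rest is linear over functions in [X]. The section [Z] is the differential of [f]. *)
Lemma anchor_vec_lin f : exists Z : section G, forall (X : section F) x,
  ev (X x) (Z x) = pbracket B (io X) (pull G f) (existT _ x (0 : G x)).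
Proof.
pose T X := Cinf (smooth_comp_section (pbracket B (io X) (pull G f)) (section0 G)).
apply: (tensorial_rep dp (T := T)) => g X Y; apply: cinf_ext => x.
rewrite -[LHS]/(pbracket B (io (section_lin g X Y)) (pull G f) (existT _ x (0 : G x))).
rewrite io_lin pbracketDl pbracketMl.
rewrite -[LHS]/(g x * pbracket B (io X) (pull G f) (existT _ x (0 : G x)) +
  io X (existT _ x (0 : G x)) * pbracket B (pull G g) (pull G f) (existT _ x (0 : G x)) +
  pbracket B (io Y) (pull G f) (existT _ x (0 : G x))).
by rewrite ioE (ev0r dp) mul0r addr0.
Qed.

(** The sections [Z f] inherit linearity and the Leibniz rule in [f], so pairing them with [u]
    defines a tangent vector, the anchor of [u]. By [pbracket_pull_basic] the identity extends from
    the zero section to the whole fibre. *)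
Lemma anchor_exists : exists alpha : anchor_map F, forall X f,
  pull G (act alpha X f) = pbracket B (io X) (pull G f).
Proof.
have /choice[Z ZE] := anchor_vec_lin.
have Z_lin a f g x : Z (a *: f + g) x = a *: Z f x + Z g x.
  apply: (ev_injr dp) => X; rewrite evlinr !ZE pull_lin pbracketDr// pbracketZr//.
have Z_der f g x : Z (f * g) x = f x *: Z g x + g x *: Z f x.
  apply: (ev_injr dp) => X; rewrite evlinr (ev_scaler dp) !ZE pullM pbracketMr//.
have der x (u : F x) : (fun f => ev u (Z f x)) \in derivation x.
  apply/derivationP; split=> [a f g|f g]; first by rewrite Z_lin evlinr.
  by rewrite Z_der evlinr (ev_scaler dp).
have lin x : linear (fun u : F x => Tangent (der x u)).
  by move=> a u u'; apply: val_inj; apply/funext => f /=; rewrite evlinl.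
pose LM x := GRing.isLinear.Build R (F x) (tangent x) *:%R _ (lin x).
pose L x : {linear F x -> tangent x} := HB.pack (fun u : F x => Tangent (der x u)) (LM x).
have sm (X : section F) (f : cinf M) : (fun x => L x (X x) f) \in smooth.
  exact: (ev_smooth dp X (Z f)).
exists (AnchorMap sm) => X f; apply: cinf_ext => -[x v] /=.
by rewrite ZE [RHS]pbracket_pull_basic.
Qed.

Lemma anchorE X f : pull G (act (anchor io B) X f) = pbracket B (io X) (pull G f).
Proof.
exact: (@theP _ _ (fun alpha => forall X f, pull G (act alpha X f) = _) anchor_exists).
Qed.

Lemma bracket_lin X f Y Z x :
  bracket io B X (section_lin f Y Z) x =
  f x *: bracket io B X Y x + act (anchor io B) X f x *: Y x + bracket io B X Z x.
Proof.
apply: (ev_injl dp) => V; rewrite -addrA !evlinl.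
have -> : act (anchor io B) X f x = pbracket B (io X) (pull G f) (existT _ x (V x)).
  by rewrite -anchorE.
rewrite -!ioE !bracketE io_lin pbracketDr// pbracketMr// [RHS]addrA.
by congr (_ + _); congr (_ + _); rewrite mulrC.
Qed.

Lemma bracket0r X x : bracket io B X (section0 F) x = 0.
Proof.
have := bracket_lin X (-1) (section0 F) (section0 F) x.
have -> : section_lin (-1) (section0 F) (section0 F) = section0 F.
  by apply: section_ext => y; rewrite section_linE scaler0 addr0.
by rewrite scaler0 addr0 cinfN scaleN1r addNr.
Qed.

Lemma bracketC X Y x : bracket io B X Y x = - bracket io B Y X x.
Proof.
apply: (ev_injl dp) => V; rewrite -scaleN1r (ev_scalel dp) -!ioE !bracketE mulN1r.
by rewrite pbracketC.
Qed.

Lemma linear_bivector_pre_lie : defines_pre_lie io B.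
Proof.
split; [split=> [||] | exact: bracketE | exact: anchorE].
- exact: bracketC.
- move=> a X Y Z x; rewrite bracket_lin.
  (* Tangent vectors annihilate constants, so no derivative term remains. *)
  have -> : act (anchor io B) X (a *: (1 : cinf M)) x = 0 by apply: tangent_scalar.
  by rewrite scale0r addr0; congr (_ *: _ + _); apply: mulr1.
- by move=> X Y f x; rewrite bracket_lin bracket0r addr0.
Qed.

End LinearBivector.

(** * Differential, Lie derivative and contraction for a linear bivector field *)

Section Calculus.
Variables (R : realType) (M : manifold R) (E : vbundle M).
Variable Lam : tensor_field (tot (dual_bundle E)) 2.
Hypothesis linL : linear_bivector (@iota_dual R M E) Lam.
Implicit Types (X Y Z : section E) (mu nu : section (dual_bundle E)) (f g : cinf M).

Let dpE := dual_bundle_pairing E.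
Let ioE X x (a : dual (E x)) :
  iota_dual X (existT (fun x => dual_bundle E x) x a) = a (X x).
Proof. by []. Qed.

Lemma bracketLamE X Y : iota_dual (bracketLam Lam X Y) =
  pbracket Lam (iota_dual X) (iota_dual Y).
Proof. exact: (bracketE dpE ioE linL). Qed.

Lemma anchorLamE X f : pull (dual_bundle E) (act (anchorLam Lam) X f) =
  pbracket Lam (iota_dual X) (pull _ f).
Proof. exact: (anchorE dpE ioE linL). Qed.

Lemma bracketLam_lin X f Y Z x : bracketLam Lam X (section_lin f Y Z) x =
  f x *: bracketLam Lam X Y x + act (anchorLam Lam) X f x *: Y x + bracketLam Lam X Z x.
Proof. exact: (bracket_lin dpE ioE linL). Qed.

Lemma bracketLamC X Y x : bracketLam Lam X Y x = - bracketLam Lam Y X x.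
Proof. exact: (bracketC dpE ioE linL). Qed.

Lemma bracketLam0r X x : bracketLam Lam X (section0 E) x = 0.
Proof. exact: (bracket0r dpE ioE linL). Qed.

Lemma act_lin (F : vbundle M) (alpha : anchor_map F) h (X Y : section F) g x :
  act alpha (section_lin h X Y) g x = h x * act alpha X g x + act alpha Y g x.
Proof. by rewrite /act /= linearP. Qed.

Lemma act0 (F : vbundle M) (alpha : anchor_map F) f x :
  act alpha (section0 F) f x = 0.
Proof. by rewrite /act /= linear0. Qed.

Lemma pairing_lin f X Y mu :
  pairing (section_lin f X Y) mu = f * pairing X mu + pairing Y mu.
Proof. by apply: cinf_ext => x; rewrite /= linearP. Qed.

Lemma dLamE f X : pairing X (dLam Lam f) = act (anchorLam Lam) X f.
Proof.
move: X; apply: (@theP _ _ (fun mu => forall X, pairing X mu = _)).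
pose T X := act (anchorLam Lam) X f.
have TD g X Y : T (section_lin g X Y) = g * T X + T Y.
  by apply: cinf_ext => x; apply: act_lin.
have [Z ZE] := tensorial_rep dpE TD.
by exists Z => X; apply: cinf_ext => x; apply: ZE.
Qed.

(** When [Y] is multiplied by [f], the two terms produce the same multiple of alpha(X)(f) with
    opposite signs. The right-hand side is therefore tensorial in [Y] and represented by a
    section. *)
Lemma lieLamE X mu Y : pairing Y (lieLam Lam X mu) =
  act (anchorLam Lam) X (pairing Y mu) - pairing (bracketLam Lam X Y) mu.
Proof.
move: Y; apply: (@theP _ _ (fun nu => forall Y, pairing Y nu = _)).
pose T Y := act (anchorLam Lam) X (pairing Y mu) - pairing (bracketLam Lam X Y) mu.
have TD f Y Y' : T (section_lin f Y Y') = f * T Y + T Y'.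
  apply: cinf_ext => x; rewrite /T pairing_lin.
  pose v : tangent x := anchorLam Lam x (X x).
  rewrite -[LHS]/(v (f * pairing Y mu + pairing Y' mu) -
    mu x (bracketLam Lam X (section_lin f Y Y') x)).
  rewrite -[RHS]/(f x * (v (pairing Y mu) - mu x (bracketLam Lam X Y x)) +
    (v (pairing Y' mu) - mu x (bracketLam Lam X Y' x))).
  rewrite bracketLam_lin raddfD/= tangentM !linearD !linearZ /=.
  rewrite /GRing.scale /= /v.
  ring.
have [Z ZE] := tensorial_rep dpE TD.
by exists Z => Y; apply: cinf_ext => x; apply: ZE.
Qed.

Lemma pair2_linl (V : lmodType R) (A : tensor V 2) r (a b c : dual V) :
  A (pair2 (r *: a + b) c) = r * A (pair2 a c) + A (pair2 b c).
Proof.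
have updc d : pair2 d c = upd (pair2 c c) ord0 d.
  by apply/funext => j; rewrite /upd /pair2; case: eqP.
by rewrite (updc (r *: a + b)) (updc a) (updc b) tensor_funP.
Qed.

Lemma pair2_linr (V : lmodType R) (A : tensor V 2) r (a b c : dual V) :
  A (pair2 c (r *: a + b)) = r * A (pair2 c a) + A (pair2 c b).
Proof.
have updc d : pair2 c d = upd (pair2 c c) (lift ord0 ord0) d.
  by apply/funext => j; rewrite /upd /pair2; case: (unliftP ord0 j) => [k|] ->//=; rewrite ord1.
by rewrite (updc (r *: a + b)) (updc a) (updc b) tensor_funP.
Qed.

Lemma contractE (P : tensor_section E 2) mu nu x :
  nu x (contract P mu x) = P x (pair2 (mu x) (nu x)).
Proof.
move: nu x; apply: (@theP _ _ (fun X => forall nu x, nu x (X x) = _)).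
have TD f nu nu' :
    tsec_eval P mu (section_lin f nu nu') = f * tsec_eval P mu nu + tsec_eval P mu nu'.
  by apply: cinf_ext => x; apply: pair2_linr.
have [Z ZE] := tensorial_rep (dual_pairing_sym dpE) TD.
by exists Z.
Qed.

End Calculus.

(** * Differentials of fibrewise affine functions in bundle charts *)

Section FibreDerivative.
Variables (R : realType) (M : manifold R) (G : vbundle M).

(** The functions [iota_dual X], [iota_bundle mu] and [pull G f] are all affine along the fibres in
    a bundle chart, so this computes the differentials compared by [canonical_iso]. *)
Lemma derive_fibre_affine (h : tot G -> R) (c : chart M) (i : triv G)
    (a : 'I_(rk G) -> 'rV[R]_(dim M) -> R) (p : 'rV[R]_(dim M) -> R)
    u v du dv :
  cdom c u -> tdom i (cpar c u) ->
  (forall k, differentiable (a k) u) -> differentiable p u ->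
  (forall u' v', cdom c u' -> tdom i (cpar c u') ->
     h (existT _ (cpar c u') (tpar i (cpar c u') v')) =
     \sum_k v' ord0 k * a k u' + p u') ->
  'D_(row_mx du dv) (h \o cpar ((c, i) : chart (tot G))) (row_mx u v) =
  \sum_k (dv ord0 k * a k u + v ord0 k * 'D_du (a k) u) + 'D_du p u.
Proof.
move=> cu iu da dp hE.
pose H : 'rV[R]_(dim M + rk G) -> R :=
  \sum_k ((fun z => rsubmx z ord0 k) * (a k \o lsubmx)) + (p \o lsubmx).
have DL (q : 'rV[R]_(dim M) -> R) :
    'D_(row_mx du dv) (q \o (@lsubmx R 1 (dim M) (rk G))) (row_mx u v) = 'D_du q u.
  rewrite /derive /=.
  have E (t : R) : lsubmx (t *: row_mx du dv + row_mx u v) = t *: du + u.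
    by rewrite scale_row_mx add_row_mx row_mxKl.
  by under eq_fun do rewrite E row_mxKl.
have dL (q : 'rV[R]_(dim M) -> R) : differentiable q u ->
    differentiable (q \o (@lsubmx R 1 (dim M) (rk G))) (row_mx u v).
  move=> dq; apply: differentiable_comp; first exact: differentiable_lsubmx.
  by rewrite row_mxKl.
have rE k : (fun z : 'rV[R]_(dim M + rk G) => rsubmx z ord0 k) =
    (fun z => z ord0 (rshift (dim M) k)) by apply/funext => z; rewrite mxE.
have dr k : differentiable (fun z : 'rV[R]_(dim M + rk G) => rsubmx z ord0 k) (row_mx u v).
  by rewrite rE; apply: differentiable_coord.
have Dr k : 'D_(row_mx du dv) (fun z : 'rV[R]_(dim M + rk G) => rsubmx z ord0 k)
    (row_mx u v) = dv ord0 k.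
  rewrite rE; have /matrixP/(_ ord0 (rshift (dim M) k)) :=
    derive_mx (@derivable_id _ _ (row_mx u v : 'rV[R]_(dim M + rk G)) (row_mx du dv)).
  by rewrite derive_id row_mxEr mxE => ->.
transitivity ('D_(row_mx du dv) H (row_mx u v)).
  apply: near_eq_derive.
  have : nbhs (row_mx u v : 'rV[R]_(dim M + rk G)) (cdom ((c, i) : chart (tot G))).
    by apply: open_nbhs_nbhs; split; [exact: (@tot_open _ _ G (c, i))|rewrite /= row_mxKl].
  apply: filterS => z [cz iz] /=; rewrite hE// /H !fctE fct_sumE.
  by congr (_ + _).
have dM k : derivable ((fun z : 'rV[R]_(dim M + rk G) => rsubmx z ord0 k) *
    (a k \o lsubmx)) (row_mx u v) (row_mx du dv).
  by apply: derivableM; [exact/diff_derivable/dr|exact/diff_derivable/dL].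
rewrite deriveD; last 2 first.
- by apply: derivable_sum.
- exact/diff_derivable/dL.
rewrite DL derive_sum//; congr (_ + _); apply: eq_bigr => k _.
rewrite deriveM; [|exact/diff_derivable/dr|exact/diff_derivable/dL].
by rewrite DL Dr /= row_mxKl row_mxKr addrC /GRing.scale /= [a k u * _]mulrC.
Qed.

End FibreDerivative.

(** * The complete lift *)

Section VerticalVectors.
Variables (R : realType) (M : manifold R) (E : vbundle M).
Variables (y : tot E) (e : E (projT1 y)).

Lemma vert_iota_bundle (mu : section (dual_bundle E)) :
  @vert R M E y e (iota_bundle mu) = mu (projT1 y) e.
Proof.
rewrite /= /vert_fun derive1E /=.
have -> : (fun s : R => mu (projT1 y) (projT2 y + s *: e)) =
    cst (mu (projT1 y) (projT2 y)) + (mu (projT1 y) e \*: id).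
  by apply/funext => s; rewrite !fctE linearD linearZ /= /GRing.scale /= mulrC.
rewrite deriveD; [|exact: derivable_cst|by apply: derivableZ; exact: derivable_id].
rewrite derive_cst deriveZ; last exact: derivable_id.
by rewrite derive_id add0r [LHS]mulr1.
Qed.

Lemma vert_pull (f : cinf M) : @vert R M E y e (pull E f) = 0.
Proof. exact: (derive1_cst (f (projT1 y))). Qed.

End VerticalVectors.

Section CompleteLift.
Variables (R : realType) (M : manifold R) (E : vbundle M).
Variable Lam : tensor_field (tot (dual_bundle E)) 2.
Hypothesis linL : linear_bivector (@iota_dual R M E) Lam.
Variable dT : forall k, tensor_section E k -> tensor_field (tot E) k.
Hypothesis liftT : complete_lift Lam dT.
Implicit Types (X Y Z : section E) (mu nu : section (dual_bundle E)) (f g : cinf M).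

(* In dual local coordinates the isomorphism sends the differential of
   [iota Y - <Y, mu> - f] at [mu x] to that of [iota mu + f] at [Y x]. *)
Lemma complete_lift_section X mu f Y x :
  dT (tsection1 X) (existT _ x (Y x)) (fun=> diff_at (iota_bundle mu + pull E f) _) =
  act (anchorLam Lam) X (pairing Y mu + f) x - mu x (bracketLam Lam X Y x).
Proof.
have [c [u [cu xE]]] := cpar_cover x; have [i ix] := tdom_cover E x.
subst x; set x := cpar c u in ix *.
pose w : 'rV[R]_(dim M + rk E) := row_mx u (tco i x (Y x)).
pose z : 'rV[R]_(dim M + rk E) := row_mx u (dco i x (mu x)).
have cw : cdom ((c, i) : chart (tot E)) w by rewrite /= row_mxKl.
have cz : cdom ((c, i) : chart (tot (dual_bundle E))) z by rewrite /= row_mxKl.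
have wE : cpar ((c, i) : chart (tot E)) w = existT _ x (Y x).
  by rewrite /= row_mxKl row_mxKr tcoK.
have zE : cpar ((c, i) : chart (tot (dual_bundle E))) z =
    existT (fun x => dual_bundle E x) x (mu x).
  by rewrite /= row_mxKl row_mxKr; congr (existT _ _ _); exact: dcoK.
set g := iota_bundle mu + pull E f.
pose h := iota_dual Y - pull (dual_bundle E) (pairing Y mu + f).
have [_ _ _ lift1] := liftT.
suff iso : canonical_iso cz cw (diff_at h _) (diff_at g _).
  have := lift1 X c i z w cz cw _ _ iso; rewrite wE zE => ->.
  (* On the vector field of [iota_dual X] the differential of [h] gives {Y, X} - {<Y, mu> + f, X} at
     [mu x]; skew-symmetry turns this into the bracket and the anchor applied to [X]. *)
  rewrite -[LHS]/(ham Lam (iota_dual X) (existT _ x (mu x)) h) raddfB /=.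
  rewrite -[X in _ - X]/(pbracket Lam (pull _ _) (iota_dual X) (existT _ x (mu x))).
  rewrite (pbracketC linL.1 (pull _ _)) -(anchorLamE linL).
  rewrite -[X in X - _]/(pbracket Lam (iota_dual Y) (iota_dual X) (existT _ x (mu x))).
  rewrite -(bracketLamE linL) /= (bracketLamC linL) linearN /=.
  by rewrite addrC opprK.
pose aY (k : 'I_(rk E)) (u' : 'rV[R]_(dim M)) : R := tco i (cpar c u') (Y (cpar c u')) ord0 k.
pose am (k : 'I_(rk E)) (u' : 'rV[R]_(dim M)) : R := dco i (cpar c u') (mu (cpar c u')) ord0 k.
have diY k : differentiable (aY k) u.
  exact: (Cinfty_diff (secP Y i k c)).
have diM k : differentiable (am k) u.
  exact: (Cinfty_diff (@secP _ _ (dual_bundle E) mu i k c)).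
pose p := (pairing Y mu \o cpar c) : 'rV[R]_(dim M) -> R.
pose q := (f \o cpar c) : 'rV[R]_(dim M) -> R.
have dp : differentiable p u by apply: cinf_diff.
have dq : differentiable q u by apply: cinf_diff.
(* The summands with derivatives of [Y] cancel in the base derivatives of [h], leaving exactly minus
   those of [g]. *)
have Dp du : 'D_du p u = \sum_k (aY k u * 'D_du (am k) u + am k u * 'D_du (aY k) u).
  transitivity ('D_du (\sum_k aY k * am k) u).
    apply: near_eq_derive.
    have : nbhs u (cdom c `&` cpar c @^-1` tdom i).
      by apply: open_nbhs_nbhs; split=> //; exact: tdom_open.
    apply: filterS => u' [cu' iu']; rewrite /p fct_sumE /=.
    by rewrite -{1}(tcoK iu' (Y (cpar c u'))) dual_tparE.
  rewrite derive_sum => [|k]; last by apply: derivableM; exact: diff_derivable.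
  by apply: eq_bigr => k _; rewrite deriveM//; exact: diff_derivable.
have Dh du dv : 'D_(row_mx du dv) (h \o cpar ((c, i) : chart (tot (dual_bundle E)))) z =
    \sum_k (dv ord0 k * aY k u + am k u * 'D_du (aY k) u) - ('D_du p u + 'D_du q u).
  rewrite (@derive_fibre_affine _ _ (dual_bundle E) _ _ _ aY (- (p + q)))//.
    rewrite deriveN ?deriveD//; try exact: diff_derivable.
    by apply: derivableD; exact: diff_derivable.
  by apply: differentiableN; exact: differentiableD.
have Dg du dv : 'D_(row_mx du dv) (g \o cpar ((c, i) : chart (tot E))) w =
    \sum_k (dv ord0 k * am k u + aY k u * 'D_du (am k) u) + 'D_du q u.
  rewrite (@derive_fibre_affine _ _ E _ _ _ am q)// => u' v' _ _.
  by rewrite -dual_tparE.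
have pick (b : 'I_(rk E) -> R) k :
    \sum_l ((delta_mx ord0 k : 'rV[R]_(rk E)) ord0 l * b l) = b k.
  rewrite (bigD1 k)//= big1 ?addr0 ?mxE ?eqxx ?mul1r// => l lk.
  by rewrite mxE (negPf lk) andbF mul0r.
split=> [|k|a|k].
- by rewrite !row_mxKl.
- rewrite /= delta_mx_rshift Dh !derive0 addr0 subr0 row_mxKr.
  rewrite -[LHS]/(aY k u) -(pick (aY^~ u)); apply: eq_bigr => l _.
  by rewrite derive0 mulr0 addr0.
- rewrite /= delta_mx_lshift Dh Dg Dp.
  have drop0 (b d : 'I_(rk E) -> R) :
      \sum_l ((0 : 'rV[R]_(rk E)) ord0 l * b l + d l) = \sum_l d l.
    by apply: eq_bigr => l _; rewrite mxE mul0r add0r.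
  by rewrite !drop0 big_split /=; ring.
- rewrite /= delta_mx_rshift Dg derive0 addr0 row_mxKr.
  rewrite -[RHS]/(am k u) -(pick (am^~ u)); apply: eq_bigr => l _.
  by rewrite derive0 mulr0 addr0.
Qed.

End CompleteLift.

(** * Frame expansions of 2-tensors and their complete lifts *)

Section TwoTensors.
Variables (R : realType) (M : manifold R) (E : vbundle M).
Implicit Types (X Y Z : section E) (mu nu : section (dual_bundle E)) (f g : cinf M).
Implicit Types (A : tensor_section E 2).

Lemma pair2_eta (T : Type) (t : 'I_2 -> T) : t = pair2 (t ord0) (t (lift ord0 ord0)).
Proof.
apply/funext => j; rewrite /pair2.
by case: (unliftP ord0 j) => [k|] ->//=; rewrite ord1.
Qed.

Lemma tsection_ext k (A B : tensor_section E k) : (forall x t, A x t = B x t) -> A = B.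
Proof.
case: A B => [A PA] [B PB] /= AB.
have AE : A = B.
  apply: functional_extensionality_dep => x; move: (AB x); clear PA PB AB.
  case: (A x) (B x) => [a Pa] [b Pb] /= ab.
  have abE : a = b by apply/funext.
  by subst b; congr Tensor; apply: Prop_irrelevance.
by subst B; congr TensorSection; apply: Prop_irrelevance.
Qed.

(** Writing this as a product with a tensor of degree 0 makes the product rule of [complete_lift]
    available; the degree [0 + 2] computes to [2]. *)
Definition tscale f A : tensor_section E 2 := tsection_prod (tsection0 E f) A.

Lemma tscaleE f A x t : tscale f A x t = f x * A x t.
Proof. by congr (_ * A x _); apply/funext => j; congr t; apply: val_inj. Qed.

Definition tprod X Y : tensor_section E 2 := tsection_prod (tsection1 X) (tsection1 Y).

Lemma tprodE X Y x a b : tprod X Y x (pair2 a b) = a (X x) * b (Y x).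
Proof. by []. Qed.

(** Both arguments of [A] are multiplied by the cut-off of the frame and expanded, so its square
    appears on the left. The coefficients are values of [A] on pairs of dual sections, hence skew if
    [A] is. *)
Lemma tensor_frame A x0 : exists (n : nat) (phi : cinf M) (eps : 'I_n -> section E)
    (c : 'I_n * 'I_n -> cinf M),
  [/\ phi x0 = 1, (forall v : tangent x0, v phi = 0),
      (forall x a b, phi x * A x (pair2 a b) =
         \sum_s c s x * (a (eps s.1 x) * b (eps s.2 x))) &
      (skew_section A -> forall s, c (s.2, s.1) = - c s)].
Proof.
have [n [phi [eps [th [phi1 dphi _ fr]]]]] := ev_frame (dual_bundle_pairing E) x0.
exists n, (phi * phi), eps, (fun s => tsec_eval A (th s.1) (th s.2)); split.
- by rewrite cinfM phi1 mulr1.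
- by move=> v; rewrite tangentM dphi !mulr0 addr0.
- move=> x a b; rewrite cinfM.
  transitivity (A x (pair2 (phi x *: a) (phi x *: b))).
    rewrite (lin_formZ (fun r u v => pair2_linl (A x) r u v _)).
    by rewrite (lin_formZ (fun r u v => pair2_linr (A x) r u v a)) mulrA.
  rewrite !fr (lin_form_sum (fun r u v => pair2_linl (A x) r u v _)).
  transitivity (\sum_i \sum_j
      tsec_eval A (th i) (th j) x * (a (eps i x) * b (eps j x))); last first.
    by rewrite pair_bigA.
  apply: eq_bigr => i _.
  rewrite (lin_form_sum (fun r u v => pair2_linr (A x) r u v _)) mulr_sumr.
  by apply: eq_bigr => j _ /=; ring.
- by move=> skA [i j]; apply: cinf_ext => x; apply: skA.
Qed.

(** The complete lift is linear over the reals only, so function coefficients stay inside the terms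
    [C s]. *)
Lemma tsection_sum_ind (T : tensor_section E 2 -> R) I (r : seq I)
    (C : I -> tensor_section E 2) A :
  (forall a B B', T (tsection_lin a B B') = a * T B + T B') ->
  (forall x t, A x t = \sum_(s <- r) C s x t) ->
  T A = \sum_(s <- r) T (C s).
Proof.
move=> TD; elim: r A => [|s r IHr] A AE.
  (* For the empty sum [A] is zero, hence equal to [- A + A], which forces [T A = 0]. *)
  have E0 : tsection_lin (-1) A A = A.
    by apply: tsection_ext => x t /=; rewrite AE big_nil mulr0 addr0.
  by have := TD (-1) A A; rewrite E0 mulN1r addNr big_nil.
rewrite big_cons -(IHr (tsection_lin (-1) (C s) A)).
  by rewrite TD mulN1r addNKr.
by move=> x t /=; rewrite AE big_cons mulN1r addKr.
Qed.

End TwoTensors.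

Section CompleteLiftTwo.
Variables (R : realType) (M : manifold R) (E : vbundle M).
Variable Lam : tensor_field (tot (dual_bundle E)) 2.
Hypothesis linL : linear_bivector (@iota_dual R M E) Lam.
Variable dT : forall k, tensor_section E k -> tensor_field (tot E) k.
Hypothesis liftT : complete_lift Lam dT.
Implicit Types (X Y Z : section E) (mu nu : section (dual_bundle E)) (f g : cinf M).
Implicit Types (A : tensor_section E 2).

Lemma dLam_act f x Y : dLam Lam f x (Y x) = act (anchorLam Lam) Y f x.
Proof. by rewrite -dLamE. Qed.

Lemma complete_lift_tscale f A x Y t (y := existT (fun x => E x) x (Y x)) :
  dT (tscale f A) y t =
  act (anchorLam Lam) Y f x * @vlift R M E y _ (A x) t + f x * dT A y t.
Proof.
have [_ liftM lift0 _] := liftT.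
have rE : t \o @rshift 0 2 = t by apply/funext => j; congr t; apply: val_inj.
have := liftM 0%N 2%N (tsection0 E f) A y t; rewrite -/(tscale f A) => ->.
rewrite -dLam_act.
rewrite /tensor_prod /= lift0 rE.
by congr (_ * A x _ + _); apply/funext => j; congr (dual_pull _ (t _)); apply: val_inj.
Qed.

Lemma complete_lift_tprod X Z y a b :
  dT (tprod X Z) y (pair2 a b) =
  dT (tsection1 X) y (fun=> a) * b (@vert R M E y (Z (projT1 y))) +
  a (@vert R M E y (X (projT1 y))) * dT (tsection1 Z) y (fun=> b).
Proof.
have [_ liftM _ _] := liftT.
have lE : pair2 a b \o @lshift 1 1 = fun=> a by apply/funext => j; rewrite ord1.
have rE : pair2 a b \o @rshift 1 1 = fun=> b by apply/funext => j; rewrite ord1.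
have := liftM 1%N 1%N (tsection1 X) (tsection1 Z) y (pair2 a b).
rewrite -/(tprod X Z) => ->; rewrite /tensor_prod /=.
by rewrite lE rE.
Qed.

(** After [A] is replaced by its product with [phi], the product rule applies to each term of the
    expansion: the first summand differentiates the coefficient, the other two the frame
    sections. *)
Lemma complete_lift_two A x Y n (phi : cinf M) (eps : 'I_n -> section E)
    (c : 'I_n * 'I_n -> cinf M) a b (y := existT (fun x => E x) x (Y x)) :
  phi x = 1 -> (forall v : tangent x, v phi = 0) ->
  (forall x a b, phi x * A x (pair2 a b) =
     \sum_s c s x * (a (eps s.1 x) * b (eps s.2 x))) ->
  let vv X := @vert R M E y (X x) in
  dT A y (pair2 a b) = \sum_s
    (act (anchorLam Lam) Y (c s) x * (a (vv (eps s.1)) * b (vv (eps s.2))) +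
     c s x * (dT (tsection1 (eps s.1)) y (fun=> a) * b (vv (eps s.2)) +
              a (vv (eps s.1)) * dT (tsection1 (eps s.2)) y (fun=> b))).
Proof.
move=> phi1 dphi AE vv; have [liftD _ _ _] := liftT.
have -> : dT A y (pair2 a b) = dT (tscale phi A) y (pair2 a b).
  rewrite complete_lift_tscale phi1 mul1r.
  have -> : act (anchorLam Lam) Y phi x = 0 by apply: dphi.
  by rewrite mul0r add0r.
rewrite (tsection_sum_ind (T := fun A => dT A y (pair2 a b)) (r := index_enum _)
  (C := fun s => tscale (c s) (tprod (eps s.1) (eps s.2)))) => [||x' t].
- by apply: eq_bigr => s _; rewrite complete_lift_tscale complete_lift_tprod.
- by move=> r B B'; apply: liftD.
rewrite tscaleE [t]pair2_eta AE; apply: eq_bigr => s _.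
by rewrite tscaleE tprodE.
Qed.

End CompleteLiftTwo.

(** * Bracket and anchor of the lifted bivector field *)

Section LiftedBivector.
Variables (R : realType) (M : manifold R) (E : vbundle M).
Variable Lam : tensor_field (tot (dual_bundle E)) 2.
Hypothesis linL : linear_bivector (@iota_dual R M E) Lam.
Variable dT : forall k, tensor_section E k -> tensor_field (tot E) k.
Hypothesis liftT : complete_lift Lam dT.
Variable P : tensor_section E 2.
Hypothesis skewP : skew_section P.
Implicit Types (X Y Z : section E) (mu nu : section (dual_bundle E)) (f g : cinf M).

Let A := anchorLam Lam.

(** The value of L_Z mu on [Y] at [x]. The argument [Z] comes last because it is the one in which
    P_mu gets expanded. *)
Let lie mu Y x Z := act A Z (pairing Y mu) x - mu x (bracketLam Lam Z Y x).

Let lie_act mu Y x Z : lieLam Lam Z mu x (Y x) = lie mu Y x Z.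
Proof. by have /(congr1 (fun h : cinf M => h x)) := lieLamE linL Z mu Y. Qed.

(** This is L_{fX} mu = f L_X mu + <X, mu> df, which comes from [fX, Y] = f[X, Y] - alpha(Y)(f) X,
    in the form required by [section_sum_ind]. *)
Let lie_lin mu Y x f X Z : lie mu Y x (section_lin f X Z) =
  (f x * lie mu Y x X + act A Y f x * mu x (X x)) + lie mu Y x Z.
Proof.
rewrite /lie act_lin bracketLamC// bracketLam_lin//.
rewrite (bracketLamC linL X Y) (bracketLamC linL Z Y) !linearN !linearD !linearZ /=.
rewrite /GRing.scale /= -/A.
ring.
Qed.

Let lie0 mu Y x : lie mu Y x (section0 E) = 0.
Proof.
by rewrite /lie act0 bracketLamC// bracketLam0r// oppr0 linear0 subr0.
Qed.

Lemma complete_lift_iota X mu Y x :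
  dT (tsection1 X) (existT _ x (Y x)) (fun=> diff_at (iota_bundle mu) _) = lie mu Y x X.
Proof.
have := complete_lift_section linL liftT X mu 0 Y x.
have -> : iota_bundle mu + pull E 0 = iota_bundle mu.
  by apply: cinf_ext => y; apply: addr0.
by rewrite addr0.
Qed.

Lemma complete_lift_pull X f Y x :
  dT (tsection1 X) (existT _ x (Y x)) (fun=> diff_at (pull E f) _) = act A X f x.
Proof.
have := complete_lift_section linL liftT X (section0 _) f Y x.
have -> : iota_bundle (section0 (dual_bundle E)) + pull E f = pull E f.
  by apply: cinf_ext => y; apply: add0r.
have -> : pairing Y (section0 (dual_bundle E)) + f = f.
  by apply: cinf_ext => y; apply: add0r.
by move=> ->; apply: subr0.
Qed.

(** Exchanging the two frame indices exchanges [a] and [b], and the skew coefficients supply the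
    sign. *)
Lemma complete_lift_bivector : bivector (dT P).
Proof.
move=> [x e] a b; have [Y Ye] := section_through (dual_bundle_pairing E) e; subst e.
have [n [phi [eps [c [phi1 dphi PE /(_ skewP) cE]]]]] := tensor_frame P x.
rewrite !(complete_lift_two liftT _ _ phi1 dphi PE).
rewrite [in RHS](reindex_inj (h := fun s : 'I_n * 'I_n => (s.2, s.1))) /=; last first.
  by move=> [i j] [i' j'] [-> ->].
rewrite -sumrN; apply: eq_bigr => s _; rewrite cE cinfN.
have -> : anchorLam Lam x (Y x) (- c s) = - anchorLam Lam x (Y x) (c s).
  exact: raddfN.
ring.
Qed.

Section Frame.
Variables (x : M) (n : nat) (phi : cinf M) (eps : 'I_n -> section E).
Variable (c : 'I_n * 'I_n -> cinf M).
Hypotheses (phi1 : phi x = 1) (dphi : forall v : tangent x, v phi = 0).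
Hypothesis PE : forall x a b, phi x * P x (pair2 a b) =
  \sum_s c s x * (a (eps s.1 x) * b (eps s.2 x)).

Lemma contract_combl mu y : section_lin phi (contract P mu) (section0 E) y =
  \sum_s (c s * pairing (eps s.1) mu) y *: eps s.2 y.
Proof.
rewrite section_linE addr0; apply: (ev_injl (dual_bundle_pairing E)) => nu.
rewrite linearZ linear_sum /= contractE /GRing.scale /= PE.
by apply: eq_bigr => s _; rewrite linearZ /= /GRing.scale /= mulrA.
Qed.

(** By skew-symmetry the expansion is made in the first slot of [P]. The same coefficients [c s]
    then occur for P_mu and P_nu, so the terms can be compared one by one. *)
Lemma contract_combr nu y : section_lin phi (contract P nu) (section0 E) y =
  \sum_s (- (c s * pairing (eps s.2) nu)) y *: eps s.1 y.
Proof.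
rewrite section_linE addr0; apply: (ev_injl (dual_bundle_pairing E)) => mu.
transitivity (- (phi y * P y (pair2 (mu y) (nu y)))).
  by rewrite linearZ /= contractE /GRing.scale /= skewP mulrN.
rewrite PE (lin_form_sum (linearP (mu y))) -sumrN; apply: eq_bigr => s _.
by rewrite cinfN cinfM /=; ring.
Qed.

(** For each [s] the Lie derivatives of [mu] and [nu] match. On the right the derivatives of the
    pairings cancel and a single derivative of [c s] along [Y] survives, as in
    [complete_lift_two]. *)
Lemma pbracket_iota_frame mu nu Y :
  pbracket (dT P) (iota_bundle mu) (iota_bundle nu) (existT _ x (Y x)) =
  lie nu Y x (contract P mu) - lie mu Y x (contract P nu) -
  act A Y (tsec_eval P mu nu) x.
Proof.
rewrite [LHS](complete_lift_two liftT _ _ phi1 dphi PE).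
(* Only the products of P_mu and P_nu with [phi] have a frame expansion; at [x] the Lie derivatives
   along them are unchanged. *)
have lie_phi nu' Z : lie nu' Y x (section_lin phi Z (section0 E)) = lie nu' Y x Z.
  rewrite lie_lin lie0 phi1 mul1r.
  have -> : act A Y phi x = 0 by apply: dphi.
  by rewrite mul0r !addr0.
rewrite -(lie_phi nu) -(lie_phi mu).
rewrite (section_sum_ind (lie0 nu Y x) (lie_lin nu Y x) (contract_combl mu)).
rewrite (section_sum_ind (lie0 mu Y x) (lie_lin mu Y x) (contract_combr nu)).
have -> : act A Y (tsec_eval P mu nu) x =
    \sum_s act A Y (c s * (pairing (eps s.1) mu * pairing (eps s.2) nu)) x.
  pose v : tangent x := A x (Y x).
  transitivity (v (phi * tsec_eval P mu nu)).
    by rewrite tangentM dphi phi1 mulr0 addr0 mul1r.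
  rewrite -(raddf_sum v); congr (v _); apply: cinf_ext => y.
  by rewrite cinf_sumE; apply: PE.
rewrite -!sumrB; apply: eq_bigr => s _.
rewrite !complete_lift_iota.
have vE nu' Z : diff_at (iota_bundle nu') (existT (fun x => E x) x (Y x))
    (@vert R M E (existT _ x (Y x)) (Z x)) = nu' x (Z x).
  exact: vert_iota_bundle.
rewrite !vE; pose v : tangent x := A x (Y x).
have actE g : act A Y g x = v g by [].
rewrite !actE cinfN (raddfN v) !cinfM /= !tangentM !cinfM /=.
ring.
Qed.

(** Vertical vectors annihilate functions pulled back from [M], so in each term only the lift of the
    second frame section contributes. *)
Lemma pbracket_pull_frame mu f Y :
  pbracket (dT P) (iota_bundle mu) (pull E f) (existT _ x (Y x)) =
  act A (contract P mu) f x.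
Proof.
rewrite [LHS](complete_lift_two liftT _ _ phi1 dphi PE).
have -> : act A (contract P mu) f x = act A (section_lin phi (contract P mu) (section0 E)) f x.
  by rewrite act_lin act0 phi1 mul1r addr0.
rewrite (section_sum_ind (T := fun Z => act A Z f x) (D := fun g Z => g x * act A Z f x)
  _ _ (contract_combl mu)); [|exact: act0|by move=> *; exact: act_lin].
apply: eq_bigr => s _.
rewrite complete_lift_pull complete_lift_iota.
have vE e : diff_at (pull E f) (existT (fun x => E x) x (Y x)) (@vert R M E _ e) = 0.
  exact: vert_pull.
have -> : diff_at (iota_bundle mu) (existT (fun x => E x) x (Y x))
    (@vert R M E (existT _ x (Y x)) (eps s.1 x)) = mu x (eps s.1 x).
  exact: vert_iota_bundle.
rewrite !vE cinfM; ring.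
Qed.

End Frame.

Lemma pbracket_iota mu nu x e :
  pbracket (dT P) (iota_bundle mu) (iota_bundle nu) (existT _ x e) =
  (lieLam Lam (contract P mu) nu x - lieLam Lam (contract P nu) mu x
   - dLam Lam (tsec_eval P mu nu) x : dual (E x)) e.
Proof.
have [Y Ye] := section_through (dual_bundle_pairing E) e; subst e.
have [n [phi [eps [c [phi1 dphi PE _]]]]] := tensor_frame P x.
by rewrite (pbracket_iota_frame phi1 dphi PE) -!lie_act -dLam_act.
Qed.

Lemma pbracket_pull mu f x e :
  pbracket (dT P) (iota_bundle mu) (pull E f) (existT _ x e) =
  act A (contract P mu) f x.
Proof.
have [Y Ye] := section_through (dual_bundle_pairing E) e; subst e.
have [n [phi [eps [c [phi1 dphi PE _]]]]] := tensor_frame P x.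
exact: (pbracket_pull_frame phi1 dphi PE).
Qed.

(** By [pbracket_iota] the bracket of two linear functions is evaluation of an element of
    [dual (E x)]. *)
Lemma complete_lift_linear : linear_bivector (@iota_bundle R M E) (dT P).
Proof.
split; first exact: complete_lift_bivector.
by move=> mu nu x r u v; rewrite !pbracket_iota linearP.
Qed.

End LiftedBivector.

Theorem theorem2p5 (R : realType) (M : manifold R) (E : vbundle M)
    (Lam : tensor_field (tot (dual_bundle E)) 2%N)
    (P : tensor_section E 2%N)
    (dT : forall k : nat, tensor_section E k -> tensor_field (tot E) k)
    (Lam_linear : linear_bivector (@iota_dual R M E) Lam)
    (P_skew : skew_section P)
    (dT_lift : complete_lift Lam dT) :
  let B := dT 2%N P in
  [/\ linear_bivector (@iota_bundle R M E) B,
      defines_pre_lie (@iota_bundle R M E) B,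
      (forall (mu nu : section (dual_bundle E)) (x : M),
         bracket (@iota_bundle R M E) B mu nu x =
           lieLam Lam (contract P mu) nu x - lieLam Lam (contract P nu) mu x
           - dLam Lam (tsec_eval P mu nu) x) &
      (forall (mu : section (dual_bundle E)) (x : M),
         anchor (@iota_bundle R M E) B x (mu x) = anchorLam Lam x (contract P mu x))].
Proof.
move=> B; have linB := complete_lift_linear Lam_linear dT_lift P_skew.
(* The results on linear bivector fields are applied with [dual_bundle E] as [F] and [E] as [G]. *)
have dpE' := dual_pairing_sym (dual_bundle_pairing E).
have ioE (mu : section (dual_bundle E)) x (e : E x) :
  iota_bundle mu (existT _ x e) = mu x e by [].
have preB := linear_bivector_pre_lie dpE' ioE linB.
split=> // [mu nu x|mu x].
- have [_ brE _] := preB; apply: val_inj; apply/funext => e.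
  rewrite -[RHS](pbracket_iota Lam_linear dT_lift P_skew).
  by rewrite -brE.
have [_ _ anE] := preB; apply: val_inj; apply/funext => f.
(* The function is constant along the fibre, so it may be evaluated at the zero vector. *)
rewrite -[RHS](pbracket_pull Lam_linear dT_lift P mu f (0 : E x)).
by rewrite -anE.
Qed.
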